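(* Assume the two-group Curie–Weiss model described in the context, with $\alpha_1>0$, $\alpha_2>0$, in the high temperature regime $J_1<\frac{1}{\alpha_1}$, $J_2<\frac{1}{\alpha_2}$, $\bar J^2<\big(\frac{1}{\alpha_1}-J_1\big)\big(\frac{1}{\alpha_2}-J_2\big)$. Then \[ \Big(\frac{1}{\sqrt{N_1}}\sum_{i=1}^{N_1}X_i,\ \frac{1}{\sqrt{N_2}}\sum_{j=1}^{N_2}Y_j\Big)\Longrightarrow \mathcal N\big((0,0),C\big)\qquad(N\to\infty), \] where \[ C=\frac{1}{(1-\alpha_1J_1)(1-\alpha_2J_2)-\alpha_1\alpha_2\bar J^2}\begin{pmatrix}1-\alpha_2J_2 & \sqrt{\alpha_1\alpha_2}\,\bar J\\ \sqrt{\alpha_1\alpha_2}\,\bar J & 1-\alpha_1J_1\end{pmatrix}. \]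
   Context: Two-group Curie–Weiss model: for each $N\in\mathbb N$ let $N_1=N_1(N)$, $N_2=N_2(N)$ be positive integers with $N_1+N_2\le N$, $N_1,N_2\to\infty$, and such that the limits $\alpha_1=\lim_{N\to\infty}N_1/N$, $\alpha_2=\lim_{N\to\infty}N_2/N$ exist. The coupling matrix is $J=\begin{pmatrix}J_1&\bar J\\ \bar J&J_2\end{pmatrix}$ with $J_1,J_2,\bar J>0$ and $\Delta:=J_1J_2-\bar J^2>0$. The spins $X_1,\dots,X_{N_1},Y_1,\dots,Y_{N_2}\in\{-1,1\}$ have joint law \[ \mathbb P(X=x,Y=y)=Z^{-1}\exp\Big(\frac{1}{2N}\Big[J_1\Big(\sum_{i}x_i\Big)^2+J_2\Big(\sum_{j}y_j\Big)^2+2\bar J\Big(\sum_{i}x_i\Big)\Big(\sum_{j}y_j\Big)\Big]\Big), \] $Z$ the normalising constant. $\mathcal N(\mu,C)$ denotes the bivariate normal law with mean $\mu$ and covariance matrix $C$; $\Longrightarrow$ is convergence in distribution. *)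

(* Defs.v *)
From Stdlib Require Import Reals Lra List Classical ClassicalEpsilon.
Import ListNotations.
Open Scope R_scope.

Definition sumR (l : list R) : R := fold_right Rplus 0 l.

Fixpoint configs (n : nat) : list (list R) :=
  match n with
  | O => [ [] ]
  | S k => map (cons 1) (configs k) ++ map (cons (-1)) (configs k)
  end.

Definition sum_configs (n1 n2 : nat) (g : list R -> list R -> R) : R :=
  sumR (map (fun x => sumR (map (fun y => g x y) (configs n2))) (configs n1)).

Definition cw_weight (N : nat) (J1 J2 Jb : R) (x y : list R) : R :=
  exp (/ (2 * INR N) *
       (J1 * (sumR x) ^ 2 + J2 * (sumR y) ^ 2 + 2 * Jb * sumR x * sumR y)).

Definition cw_Z (N n1 n2 : nat) (J1 J2 Jb : R) : R :=
  sum_configs n1 n2 (cw_weight N J1 J2 Jb).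

Definition cw_cdf (N n1 n2 : nat) (J1 J2 Jb : R) (a b : R) : R :=
  sum_configs n1 n2 (fun x y =>
     cw_weight N J1 J2 Jb x y *
     (if Rle_dec (sumR x / sqrt (INR n1)) a then
        if Rle_dec (sumR y / sqrt (INR n2)) b then 1 else 0
      else 0))
  / cw_Z N n1 n2 J1 J2 Jb.

(** Riemann integral on [a,b] (0 if f is not Riemann integrable there). *)
Definition Rint (f : R -> R) (a b : R) : R :=
  match excluded_middle_informative
          (exists pr : Riemann_integrable f a b, True) with
  | left H => RiemannInt (proj1_sig (constructive_indefinite_description _ H))
  | right _ => 0
  end.

(** Density of the centred bivariate normal law with covariance
    matrix [[c11, c12], [c12, c22]] (assumed positive definite). *)
Definition gauss2_density (c11 c12 c22 : R) (x y : R) : R :=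
  let d := c11 * c22 - c12 ^ 2 in
  exp (- (c22 * x ^ 2 - 2 * c12 * x * y + c11 * y ^ 2) / (2 * d))
  / (2 * PI * sqrt d).

Definition is_gauss2_cdf (c11 c12 c22 : R) (a b v : R) : Prop :=
  forall eps, eps > 0 -> exists M0, forall M, M >= M0 ->
    Rabs (Rint (fun x => Rint (fun y => gauss2_density c11 c12 c22 x y) (- M) b)
               (- M) a - v) < eps.

Definition nat_to_infty (u : nat -> nat) : Prop :=
  forall M : nat, exists n0, forall n, (n >= n0)%nat -> (u n >= M)%nat.

Definition C_den (a1 a2 J1 J2 Jb : R) : R :=
  (1 - a1 * J1) * (1 - a2 * J2) - a1 * a2 * Jb ^ 2.
Definition C11 (a1 a2 J1 J2 Jb : R) : R := (1 - a2 * J2) / C_den a1 a2 J1 J2 Jb.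
Definition C12 (a1 a2 J1 J2 Jb : R) : R := sqrt (a1 * a2) * Jb / C_den a1 a2 J1 J2 Jb.
Definition C22 (a1 a2 J1 J2 Jb : R) : R := (1 - a1 * J1) / C_den a1 a2 J1 J2 Jb.

(* Main.v *)
(** The number of spin configurations of a group of [n] with magnetisation [s] is a
    binomial coefficient, so the model is a weighted sum over a product lattice.
    Dividing by the central coefficient (the normalisation cancels against [Z], so
    Stirling's formula is not needed), the binomial weight at [x = s / sqrt n] tends
    to [exp (- x^2 / 2)] locally uniformly and is at most
    [exp (- x^2 / 2 * n / (n + 1))].  In the high temperature regime the quadratic
    form obtained by adding the interaction is eventually uniformly positive
    definite; hence the weights are dominated by a fixed Gaussian and the lattice
    sums are Riemann sums converging to the integral of the limit density.
    Numerator and [Z] are treated alike, and the total mass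
    [2 PI / sqrt (A B - c^2)] comes from the one-dimensional Gaussian integral.

    Convergence of the double sum is obtained by applying a one-dimensional
    theorem twice.  It is stated along an arbitrary filter, with convergence of the
    integrands required jointly in the index and the variable, so that the
    conclusion for the inner sum is exactly the hypothesis for the outer one. *)

Require Import Defs.
From Stdlib Require Import Reals ZArith Lra Lia List Classical ClassicalEpsilon.
From Stdlib Require Import FunctionalExtensionality.
From Coquelicot Require Import Coquelicot.
Open Scope R_scope.

(** * The Gaussian integral *)

(** The obstacle is that the inner lattice sum is a function sampled by the outer one at points that
    move with the index, so pointwise convergence would not survive the second pass. Joint
    convergence in index and variable is continuous convergence: it is uniform on compact sets even
    for discontinuous approximants, and it makes the limit continuous.

    The dominating function is the rational [K / (1 + y ^ 2) ^ 2], into which the Gaussian bound is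
    weakened. One factor is summed by telescoping arctangents, uniformly in the mesh; the other is
    small far out; and a product of two such bounds in [x] and [y] is such a bound in [y] whose
    coefficient decays in [x].

    The lattice sums converge to iterated improper integrals, whereas the normal distribution
    function is specified by proper integrals over growing boxes; a separate tail estimate joins the
    two. The total mass must be computed exactly because it has to reproduce the normalising
    constant of the density. *)

Definition erf0 (x : R) : R := RInt (fun t => exp (- t ^ 2 / 2)) 0 x.

Lemma continuous_derivable (f : R -> R) (x : R) :
  ex_derive f x -> continuous f x.
Proof. exact (ex_derive_continuous f x). Qed.

Lemma continuous_gauss (x : R) : continuous (fun t => exp (- t ^ 2 / 2)) x.
Proof. apply continuous_derivable; auto_derive; auto. Qed.

Lemma ex_RInt_everywhere (f : R -> R) (a b : R) :
  (forall x, continuous f x) -> ex_RInt f a b.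
Proof. intros Hf; apply (@ex_RInt_continuous R_CompleteNormedModule); auto. Qed.

Lemma RInt_split (f : R -> R) (a b c : R) :
  (forall x, continuous f x) -> RInt f a c = RInt f a b + RInt f b c.
Proof.
  intros Hf. symmetry. apply (RInt_Chasles f a b c); apply ex_RInt_everywhere, Hf.
Qed.

Lemma is_derive_primitive (f : R -> R) (a x : R) :
  (forall z, continuous f z) -> is_derive (fun z => RInt f a z) x (f x).
Proof.
  intros Hf.
  apply (is_derive_RInt f (fun z => RInt f a z) a x); auto.
  apply filter_forall; intros y.
  apply (RInt_correct f a y), ex_RInt_everywhere, Hf.
Qed.

Lemma erf0_derive (x : R) : is_derive erf0 x (exp (- x ^ 2 / 2)).
Proof.
  apply (is_derive_primitive (fun t => exp (- t ^ 2 / 2)) 0 x), continuous_gauss.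
Qed.

(* [erf0 ^ 2 + 2 * gauss_aux] has derivative zero, which gives the Gaussian integral. *)
Definition gauss_aux (x : R) : R :=
  RInt (fun t => exp (- x ^ 2 * (1 + t ^ 2) / 2) / (1 + t ^ 2)) 0 1.

Lemma one_plus_sqr_neq0 (t : R) : 1 + t ^ 2 <> 0.
Proof. pose proof (pow2_ge_0 t); lra. Qed.

(** Differentiating under the integral sign cancels the denominator [1 + t ^ 2]. What remains is
    [- exp (- x ^ 2 / 2)] times the integral of [x * exp (- (x * t) ^ 2 / 2)], which the
    substitution [s = x * t] turns into [erf0 x]. *)
Lemma gauss_aux_derive (x : R) :
  is_derive gauss_aux x (- exp (- x ^ 2 / 2) * erf0 x).
Proof.
  unfold gauss_aux.
  assert (Hd : forall y t, is_derive
      (fun u => exp (- u ^ 2 * (1 + t ^ 2) / 2) / (1 + t ^ 2)) y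
      (- y * exp (- y ^ 2 * (1 + t ^ 2) / 2))).
  { intros y t. auto_derive; [exact I|].
    replace (- (y * (y * 1)) * (1 + t * (t * 1)) * / 2)
      with (- y ^ 2 * (1 + t ^ 2) / 2) by (unfold Rdiv; ring).
    field. pose proof (one_plus_sqr_neq0 t); lra. }
  replace (- exp (- x ^ 2 / 2) * erf0 x) with
    (RInt (fun t => Derive (fun u => exp (- u ^ 2 * (1 + t ^ 2) / 2) / (1 + t ^ 2)) x) 0 1).
  - apply (is_derive_RInt_param
      (fun u t => exp (- u ^ 2 * (1 + t ^ 2) / 2) / (1 + t ^ 2)) 0 1 x).
    + apply filter_forall. intros y t _. eexists; apply Hd.
    + intros t _. apply (continuity_2d_pt_ext
        (fun u v => - u * exp (- u ^ 2 * (1 + v ^ 2) / 2))).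
      * intros u v. symmetry. apply is_derive_unique, Hd.
      * apply continuity_2d_pt_mult.
        apply continuity_2d_pt_opp, continuity_2d_pt_id1.
        apply (continuity_1d_2d_pt_comp exp (fun u v => - u ^ 2 * (1 + v ^ 2) / 2)).
        apply derivable_continuous_pt, derivable_pt_exp.
        apply (continuity_2d_pt_ext (fun u v => - (u * u) * (1 + v * v) * / 2)).
        intros; unfold Rdiv; ring.
        repeat first [apply continuity_2d_pt_mult | apply continuity_2d_pt_plus
          | apply continuity_2d_pt_opp | apply continuity_2d_pt_id1
          | apply continuity_2d_pt_id2 | apply continuity_2d_pt_const].
    + apply filter_forall. intros y.
      apply ex_RInt_everywhere. intros t. apply continuous_derivable.
      auto_derive. apply one_plus_sqr_neq0.
  (* The summand [+ 0] gives the affine form [u * t + v] that [RInt_comp_lin] substitutes. *)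
  - rewrite (RInt_ext _ (fun t => - exp (- x ^ 2 / 2) *
       (x * exp (- (x * t + 0) ^ 2 / 2)))).
    + rewrite (RInt_scal (V := R_CompleteNormedModule)
        (fun t => x * exp (- (x * t + 0) ^ 2 / 2)) 0 1).
      * apply f_equal2; [reflexivity|].
        transitivity (RInt (fun s => exp (- s ^ 2 / 2)) (x * 0 + 0) (x * 1 + 0)).
        -- apply (RInt_comp_lin (V := R_CompleteNormedModule)
             (fun s => exp (- s ^ 2 / 2)) x 0 0 1).
           apply ex_RInt_everywhere, continuous_gauss.
        -- unfold erf0. f_equal; ring.
      * apply ex_RInt_everywhere. intros t. apply continuous_derivable.
        auto_derive. auto.
    + intros t _.
      etransitivity; [apply is_derive_unique, Hd|].
      match goal with |- ?l = ?r => change (@eq R l r) end.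
      transitivity (- x * (exp (- x ^ 2 / 2) * exp (- (x * t + 0) ^ 2 / 2))); [|ring].
      rewrite <- exp_plus. f_equal. f_equal. field.
Qed.

Lemma gauss_aux_0 : gauss_aux 0 = PI / 4.
Proof.
  unfold gauss_aux.
  rewrite (RInt_ext _ (fun t => / (1 + t ^ 2))).
  - apply is_RInt_unique.
    replace (PI / 4) with (minus (atan 1) (atan 0)).
    + apply (is_RInt_derive atan (fun t => / (1 + t ^ 2))).
      * intros x _. auto_derive; auto. unfold Rsqr. field. 
        pose proof (one_plus_sqr_neq0 x). lra.
      * intros x _. apply continuous_derivable. auto_derive. apply one_plus_sqr_neq0.
    + rewrite atan_0, atan_1. unfold minus, plus, opp; simpl; ring.
  - intros t _. replace (- 0 ^ 2 * (1 + t ^ 2) / 2) with 0 by (unfold Rdiv; ring).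
    rewrite exp_0. apply Rmult_1_l.
Qed.

Lemma erf0_sqr (x : R) : 0 <= x -> erf0 x ^ 2 = PI / 2 - 2 * gauss_aux x.
Proof.
  intros Hx.
  assert (H0 : erf0 0 = 0) by (unfold erf0; apply (RInt_point (V := R_CompleteNormedModule))).
  destruct (Req_dec x 0) as [->|Hx0].
  { rewrite gauss_aux_0, H0. field. }
  pose proof (eq_is_derive (V := R_NormedModule)
    (fun y => erf0 y ^ 2 + 2 * gauss_aux y) 0 x) as E.
  assert (E' : erf0 0 ^ 2 + 2 * gauss_aux 0 = erf0 x ^ 2 + 2 * gauss_aux x).
  { apply E; [|lra]. intros t _.
    evar_last.
    - apply (is_derive_plus (V := R_NormedModule) (fun y => erf0 y ^ 2) (fun y => 2 * gauss_aux y)).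
      + apply (is_derive_pow erf0 2). apply erf0_derive.
      + apply is_derive_scal. apply gauss_aux_derive.
    - unfold plus, zero; simpl. ring. }
  rewrite gauss_aux_0, H0 in E'. lra.
Qed.

Lemma exp_neg_le (u : R) : 0 <= u -> exp (- u) <= / (1 + u).
Proof.
  intros Hu. rewrite exp_Ropp.
  apply Rinv_le_contravar; [lra | apply exp_ineq1_le].
Qed.

(** Since [1 + t ^ 2 >= 1], the integrand is at most [exp (- x ^ 2 / 2)]. The bound is crude, but
    all it has to give is [gauss_aux x -> 0] at infinity. *)
Lemma gauss_aux_bound (x : R) : 0 <= gauss_aux x <= / (1 + x ^ 2 / 2).
Proof.
  pose proof (pow2_ge_0 x) as Hx.
  assert (Hp : 0 < / (1 + x ^ 2 / 2)) by (apply Rinv_0_lt_compat; lra).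
  assert (B : forall t, 0 < exp (- x ^ 2 * (1 + t ^ 2) / 2) / (1 + t ^ 2)
                        <= / (1 + x ^ 2 / 2)).
  { intros t. pose proof (pow2_ge_0 t) as Ht. split.
    - apply Rdiv_lt_0_compat; [apply exp_pos | lra].
    - apply Rle_trans with (exp (- x ^ 2 * (1 + t ^ 2) / 2)).
      + rewrite <- (Rmult_1_r (exp _)) at 2. apply Rmult_le_compat_l.
        apply Rlt_le, exp_pos. rewrite <- Rinv_1. apply Rinv_le_contravar; lra.
      + eapply Rle_trans; [|apply exp_neg_le; nra].
        replace (- x ^ 2 * (1 + t ^ 2) / 2) with (- (x ^ 2 / 2) - x ^ 2 * t ^ 2 / 2) by field.
        apply Rnot_lt_le. intros H. apply exp_lt_inv in H. nra. }
  assert (Hex : ex_RInt (fun t => exp (- x ^ 2 * (1 + t ^ 2) / 2) / (1 + t ^ 2)) 0 1).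
  { apply ex_RInt_everywhere. intros t. apply continuous_derivable.
    auto_derive. apply one_plus_sqr_neq0. }
  unfold gauss_aux. split.
  - apply RInt_ge_0; [lra | exact Hex | intros t _; apply Rlt_le, B].
  - replace (/ (1 + x ^ 2 / 2)) with ((1 - 0) * / (1 + x ^ 2 / 2)) by ring.
    eapply Rle_trans; [apply Rle_abs|].
    apply abs_RInt_le_const; [lra | exact Hex | intros t _].
    destruct (B t). rewrite Rabs_pos_eq; lra.
Qed.

Lemma erf0_ge0 (x : R) : 0 <= x -> 0 <= erf0 x.
Proof.
  intros Hx. apply RInt_ge_0; auto.
  apply ex_RInt_everywhere, continuous_gauss. intros; apply Rlt_le, exp_pos.
Qed.

Lemma erf0_lim : is_lim erf0 p_infty (sqrt (PI / 2)).
Proof.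
  pose proof PI_RGT_0 as Hpi.
  apply is_lim_ext_loc with (fun x => sqrt (PI / 2 - 2 * gauss_aux x)).
  { exists 0. intros x Hx. rewrite <- erf0_sqr by lra.
    rewrite <- Rsqr_pow2. apply sqrt_Rsqr, erf0_ge0; lra. }
  apply (filterlim_comp _ _ _ (fun x => PI / 2 - 2 * gauss_aux x) sqrt
    (Rbar_locally' p_infty) (locally (PI / 2))).
  - change (is_lim (fun x => PI / 2 - 2 * gauss_aux x) p_infty (PI / 2)).
    replace (Finite (PI / 2)) with (Rbar_minus (PI / 2) (Rbar_mult 2 0)) by (simpl; f_equal; ring).
    apply is_lim_minus'; [apply is_lim_const|].
    apply (is_lim_scal_l gauss_aux 2 p_infty 0).
    apply (is_lim_le_le_loc (fun _ => 0) (fun x => / x)).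
    + exists 2. intros x Hx. destruct (gauss_aux_bound x) as [H1 H2]. split; auto.
      eapply Rle_trans; [exact H2|]. apply Rinv_le_contravar; nra.
    + apply is_lim_const.
    + replace (Finite 0) with (Rbar_inv p_infty) by reflexivity.
      apply is_lim_inv; [apply is_lim_id | discriminate].
  - apply continuity_pt_filterlim, continuity_pt_sqrt. lra.
Qed.

Lemma erf0_odd (x : R) : erf0 (- x) = - erf0 x.
Proof.
  unfold erf0.
  pose proof (RInt_comp_lin (V := R_CompleteNormedModule) (fun t => exp (- t ^ 2 / 2)) (-1) 0 0 x) as H.
  replace (-1 * 0 + 0) with 0 in H by ring.
  replace (-1 * x + 0) with (- x) in H by ring.
  rewrite <- H by apply ex_RInt_everywhere, continuous_gauss.
  rewrite (RInt_ext _ (fun t => opp (exp (- t ^ 2 / 2)))).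
  - rewrite (RInt_opp (V := R_CompleteNormedModule)); [reflexivity|].
    apply ex_RInt_everywhere, continuous_gauss.
  - intros t _. unfold scal, opp; simpl. unfold mult; simpl.
    replace (- ((-1 * t + 0) * ((-1 * t + 0) * 1)) / 2) with (- (t * (t * 1)) / 2)
      by (unfold Rdiv; ring). ring.
Qed.

(** * Riemann sums over the lattice *)

(** For [z] near [y], a proper filter supplies one index [t] that is good at both points; then
    [g t z] is within [eps / 2] of [g0 y] and of [g0 z]. *)
Lemma limit_along_continuous {T : Type} (F : (T -> Prop) -> Prop) {FF : ProperFilter F}
    (g : T -> R -> R) (g0 : R -> R) :
  (forall y, filterlim (fun p : T * R => g (fst p) (snd p))
               (filter_prod F (locally y)) (locally (g0 y))) ->
  forall y, continuous g0 y.
Proof.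
  intros H y. apply filterlim_locally. intros eps.
  pose proof (proj1 (filterlim_locally _ _) (H y) (pos_div_2 eps)) as [Q P HQ HP HQP].
  apply locally_locally in HP. revert HP. apply filter_imp. intros z Hz.
  pose proof (proj1 (filterlim_locally _ _) (H z) (pos_div_2 eps)) as [Q' P' HQ' HP' HQP'].
  destruct (filter_ex _ (filter_and _ _ HQ HQ')) as [t [Ht Ht']].
  specialize (HQP t z Ht (locally_singleton _ _ Hz)).
  specialize (HQP' t z Ht' (locally_singleton _ _ HP')).
  simpl in HQP, HQP'.
  replace (pos eps) with (eps / 2 + eps / 2) by field.
  apply (ball_triangle (g0 y) (g t z) (g0 z)); auto. apply ball_sym, HQP'.
Qed.

Lemma filter_list_forall {T U : Type} (F : (T -> Prop) -> Prop) {FF : Filter F}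
    (P : U -> T -> Prop) (l : list U) :
  (forall u, F (P u)) -> F (fun t => forall u, In u l -> P u t).
Proof.
  intros HP. induction l as [|u l IH].
  - apply filter_forall. intros t v [].
  - generalize (filter_and _ _ (HP u) IH). apply filter_imp.
    intros t [H1 H2] v [<-|Hv]; auto.
Qed.

(** Finitely many of the neighbourhoods given by joint convergence cover [[A, B]], and a filter is
    closed under finite intersections. Comparing [g t] at [y] with [g0] at a nearby [z] is what a
    Riemann sum needs: [y] is the sample point and [z] runs through its cell. *)
Lemma limit_along_uniform {T : Type} (F : (T -> Prop) -> Prop) {FF : Filter F}
    (g : T -> R -> R) (g0 : R -> R) (A B eps : R) :
  (forall y, filterlim (fun p : T * R => g (fst p) (snd p))
               (filter_prod F (locally y)) (locally (g0 y))) ->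
  (forall y, continuous g0 y) -> 0 < eps ->
  exists d, 0 < d /\ F (fun t => forall y z, A <= y <= B -> Rabs (z - y) < d ->
     Rabs (g t y - g0 z) < eps).
Proof.
  intros H Hc Heps.
  assert (He : 0 < eps / 2) by lra.
  (* The radius [2 * d] leaves room for two moves, from the centre to [y] and from [y] to [z], each
     shorter than [d]. *)
  assert (L : forall y, exists d : posreal, F (fun t => forall z,
      Rabs (z - y) < 2 * d -> Rabs (g t z - g0 y) < eps / 2) /\
      (forall z, Rabs (z - y) < 2 * d -> Rabs (g0 z - g0 y) < eps / 2)).
  { intros y.
    pose proof (proj1 (filterlim_locally _ _) (H y) (mkposreal _ He)) as [Q P HQ [d1 Hd1] HQP].
    pose proof (proj1 (filterlim_locally _ _) (Hc y) (mkposreal _ He)) as [d2 Hd2].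
    assert (Hd : 0 < Rmin d1 d2 / 2).
    { pose proof (cond_pos d1); pose proof (cond_pos d2).
      apply Rdiv_lt_0_compat; [apply Rmin_glb_lt|]; lra. }
    exists (mkposreal _ Hd). simpl.
    pose proof (Rmin_l d1 d2); pose proof (Rmin_r d1 d2). split.
    - revert HQ. apply filter_imp. intros t Ht z Hz. apply (HQP t z Ht).
      apply Hd1. change (Rabs (z - y) < d1). lra.
    - intros z Hz. apply Hd2. change (Rabs (z - y) < d2). lra. }
  destruct (choice _ L) as [delta Hdelta]. clear L.
  set (del := fun t : Compactness.Tn 1 R => delta (fst t)).
  (* [compactness_list] yields its finite cover only under a double negation. *)
  apply NNPP. intros Hn.
  apply (compactness_list 1 (A, tt) (B, tt) del). intros [l Hl]. apply Hn. clear Hn.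
  assert (Hd : exists d : R, 0 < d /\ forall t, In t l -> d <= del t).
  { clear - l. induction l as [|t l [d [Hd Hl]]].
    - exists 1. split; [lra|intros t []].
    - exists (Rmin d (del t)). split.
      + apply Rmin_glb_lt; auto. apply cond_pos.
      + intros s [<-|Hs]. apply Rmin_r. eapply Rle_trans; [apply Rmin_l|auto]. }
  destruct Hd as [d [Hd Hdl]]. exists d. split; auto.
  generalize (filter_list_forall F (fun (u : Compactness.Tn 1 R) t => forall z,
      Rabs (z - fst u) < 2 * del u -> Rabs (g t z - g0 (fst u)) < eps / 2) l
      (fun u => proj1 (Hdelta (fst u)))).
  apply filter_imp. intros t Ht y z Hy Hz.
  destruct (Hl (y, tt)) as [[u []] [Hu [_ Hc']]]; [simpl; tauto|].
  simpl in Hc'.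
  specialize (Ht _ Hu y). specialize (Hdl _ Hu).
  pose proof (proj2 (Hdelta u) z) as Hz'.
  unfold del in *; simpl in *.
  pose proof (cond_pos (delta u)).
  assert (Rabs (g t y - g0 u) < eps / 2) by (apply Ht; lra).
  assert (Rabs (g0 z - g0 u) < eps / 2).
  { apply Hz'. replace (z - u) with ((z - y) + (y - u)) by ring.
    eapply Rle_lt_trans; [apply Rabs_triang|]. lra. }
  replace (g t y - g0 z) with ((g t y - g0 u) - (g0 z - g0 u)) by ring.
  eapply Rle_lt_trans; [apply Rabs_triang|]. rewrite Rabs_Ropp. lra.
Qed.

(** * The lattice of normalised magnetisations and Riemann sums on a bounded interval *)

Lemma sum_telescope (u : nat -> R) (n : nat) :
  sum_f_R0 (fun k => u k - u (S k)) n = u O - u (S n).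
Proof. induction n as [|n IH]; simpl; [|rewrite IH]; ring. Qed.

(* The possible values of [S / sqrt n], [S] a sum of [n] spins of which [k] are [-1]. *)
Definition pt (n k : nat) : R := (INR n - 2 * INR k) / sqrt (INR n).

Definition mesh (n : nat) : R := 2 / sqrt (INR n).

Lemma sqrt_INR_pos (n : nat) : (0 < n)%nat -> 0 < sqrt (INR n).
Proof. intros Hn. apply sqrt_lt_R0, lt_0_INR, Hn. Qed.

Lemma pt_S (n k : nat) : (0 < n)%nat -> pt n (S k) = pt n k - mesh n.
Proof.
  intros Hn. pose proof (sqrt_INR_pos n Hn). unfold pt, mesh. rewrite S_INR. field. lra.
Qed.

Lemma pt_0 (n : nat) : (0 < n)%nat -> pt n 0 = sqrt (INR n).
Proof.
  intros Hn. pose proof (sqrt_INR_pos n Hn) as H.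
  unfold pt. simpl (INR 0). rewrite Rmult_0_r, Rminus_0_r.
  rewrite <- (sqrt_sqrt (INR n)) at 1 by apply pos_INR. field. lra.
Qed.

Lemma pt_last (n : nat) : (0 < n)%nat -> pt n n = - sqrt (INR n).
Proof.
  intros Hn. pose proof (sqrt_INR_pos n Hn) as H.
  unfold pt. replace (INR n - 2 * INR n) with (- INR n) by ring.
  rewrite <- (sqrt_sqrt (INR n)) at 1 by apply pos_INR. field. lra.
Qed.

Lemma mesh_pos (n : nat) : (0 < n)%nat -> 0 < mesh n.
Proof. intros Hn. pose proof (sqrt_INR_pos n Hn). apply Rdiv_lt_0_compat; lra. Qed.

Lemma sqrt_INR_large (X : R) : exists n0, forall n, (n0 <= n)%nat -> X <= sqrt (INR n).
Proof.
  destruct (archimed (X ^ 2)) as [H _]. pose proof (pow2_ge_0 X).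
  exists (Z.to_nat (up (X ^ 2))). intros n Hn.
  apply Rle_trans with (Rabs X); [apply Rle_abs|].
  rewrite <- sqrt_Rsqr_abs. apply sqrt_le_1_alt.
  assert (Hu : Z.le 0 (up (X ^ 2))) by (apply le_IZR; lra).
  apply le_INR in Hn. rewrite INR_IZR_INZ, Z2Nat.id in Hn by auto.
  rewrite Rsqr_pow2. lra.
Qed.

Lemma mesh_small (eps : R) : 0 < eps ->
  exists n0, forall n, (n0 <= n)%nat -> (0 < n)%nat /\ mesh n < eps.
Proof.
  intros He. destruct (sqrt_INR_large (4 / eps)) as [n0 H].
  exists (S n0). intros n Hn. split; [lia|].
  specialize (H n ltac:(lia)). unfold mesh.
  assert (0 < 4 / eps) by (apply Rdiv_lt_0_compat; lra).
  apply Rmult_lt_reg_r with (sqrt (INR n)); [lra|].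
  unfold Rdiv at 1. rewrite Rmult_assoc, Rinv_l by lra.
  apply Rmult_le_compat_l with (r := eps) in H; [|lra].
  replace (eps * (4 / eps)) with 4 in H by (field; lra). lra.
Qed.

(** Half-open on the left, to match the cells [(x - h, x]] attached to the lattice points: a point
    at [A] has its cell outside the interval. *)
Definition indic (A B x : R) : R :=
  if Rlt_dec A x then if Rle_dec x B then 1 else 0 else 0.

(** Integrating from [clamp A B (x - h)] to [clamp A B x] integrates over the part of the cell
    inside [[A, B]], with no case distinction in the telescoping sum. *)
Definition clamp (A B x : R) : R := Rmax A (Rmin x B).

Lemma clamp_low (A B x : R) : A <= B -> x <= A -> clamp A B x = A.
Proof. intros. unfold clamp. rewrite Rmin_left, Rmax_left; lra. Qed.

Lemma clamp_mid (A B x : R) : A <= x <= B -> clamp A B x = x.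
Proof. intros. unfold clamp. rewrite Rmin_left, Rmax_right; lra. Qed.

Lemma clamp_high (A B x : R) : A <= B -> B <= x -> clamp A B x = B.
Proof. intros. unfold clamp. rewrite Rmin_right, Rmax_right; lra. Qed.

Definition step (A x : R) : R := if Rlt_dec A x then 1 else 0.

Lemma step_low (A x : R) : x <= A -> step A x = 0.
Proof. intros. unfold step. destruct (Rlt_dec A x); lra. Qed.

Lemma step_high (A x : R) : A < x -> step A x = 1.
Proof. intros. unfold step. destruct (Rlt_dec A x); lra. Qed.

(* The last two terms pay for the cells that straddle [A] and [B]; every term
   on the right telescopes along the lattice. *)
Lemma cell_error (g g0 : R -> R) (A B K h e x : R) :
  A <= B -> 0 < h -> 0 <= e -> (forall y, continuous g0 y) ->
  (forall y, Rabs (g0 y) <= K) -> (forall y, Rabs (g y) <= K) ->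
  (forall y z, A <= y <= B -> Rabs (z - y) <= h -> Rabs (g y - g0 z) <= e) ->
  Rabs (h * (g x * indic A B x) -
        (RInt g0 A (clamp A B x) - RInt g0 A (clamp A B (x - h)))) <=
  e * (clamp A B x - clamp A B (x - h)) +
  2 * h * K * (step A x - step A (x - h)) + 2 * h * K * (step B x - step B (x - h)).
Proof.
  intros HAB Hh He Hc H0 Hg Hgg.
  assert (HK : 0 <= K) by (eapply Rle_trans; [apply Rabs_pos | apply (H0 0)]).
  assert (HhK : 0 <= h * K) by nra.
  assert (Hint : RInt g0 A (clamp A B x) - RInt g0 A (clamp A B (x - h)) =
      RInt g0 (clamp A B (x - h)) (clamp A B x)).
  { rewrite (RInt_split g0 A (clamp A B (x - h)) (clamp A B x)) by exact Hc. ring. }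
  rewrite Hint. clear Hint.
  assert (Hb : forall u v, u <= v -> Rabs (RInt g0 u v) <= (v - u) * K).
  { intros u v Huv. apply abs_RInt_le_const; auto. apply ex_RInt_everywhere, Hc. }
  assert (Hgx : Rabs (h * (g x * 1)) <= h * K).
  { rewrite Rmult_1_r, Rabs_mult, (Rabs_pos_eq h) by lra.
    apply Rmult_le_compat_l; [lra|auto]. }
  assert (Hz : forall u, RInt g0 u u = 0) by (intros; apply (RInt_point (V := R_CompleteNormedModule))).
  unfold indic.
  destruct (Rlt_dec A x) as [HA|HA]; [destruct (Rle_dec x B) as [HB|HB]|].
  - rewrite (clamp_mid A B x) by lra.
    rewrite (step_high A x), (step_low B x), (step_low B (x - h)) by lra.
    destruct (Rle_dec (x - h) A) as [HA'|HA'].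
    + rewrite (clamp_low A B (x - h)), (step_low A (x - h)) by lra.
      pose proof (Hb A x ltac:(lra)) as Hb'.
      unfold Rminus at 1. eapply Rle_trans; [apply Rabs_triang|]. rewrite Rabs_Ropp. nra.
    + rewrite (clamp_mid A B (x - h)), (step_high A (x - h)) by lra.
      replace (h * (g x * 1) - RInt g0 (x - h) x) with (RInt (fun z => g x - g0 z) (x - h) x).
      * eapply Rle_trans.
        -- apply abs_RInt_le_const with (M := e); [lra| |].
           ++ apply ex_RInt_everywhere. intros z.
              apply (continuous_minus (V := R_NormedModule) (fun _ => g x) g0); [apply continuous_const|apply Hc].
           ++ intros z Hz'. apply Hgg; [lra|]. apply Rabs_le; lra.
        -- nra.
      * rewrite (RInt_minus (V := R_CompleteNormedModule) (fun _ => g x) g0).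
        -- rewrite RInt_const. unfold minus, plus, opp, scal; simpl. unfold mult; simpl. ring.
        -- apply ex_RInt_const.
        -- apply ex_RInt_everywhere, Hc.
  - rewrite (clamp_high A B x), (step_high A x), (step_high B x) by lra.
    rewrite Rmult_0_r, Rmult_0_r, Rminus_0_l, Rabs_Ropp.
    destruct (Rle_dec (x - h) B) as [HB'|HB'].
    + rewrite (step_low B (x - h)) by lra.
      (* The cell straddles [B] and possibly [A] too; the [B] term alone pays, and the [A] term only
         has to be nonnegative. *)
      assert (HA' : step A (x - h) <= 1) by (unfold step; destruct (Rlt_dec A (x - h)); lra).
      assert (HC : x - h <= clamp A B (x - h) <= B).
      { unfold clamp. rewrite Rmin_left by lra. split; [apply Rmax_r | apply Rmax_lub; lra]. }
      eapply Rle_trans; [apply Hb; lra|]. nra.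
    + rewrite (clamp_high A B (x - h)), (step_high A (x - h)), (step_high B (x - h)) by lra.
      rewrite Hz, Rabs_R0. lra.
  - rewrite (clamp_low A B x), (clamp_low A B (x - h)), (step_low A x), (step_low A (x - h)),
      (step_low B x), (step_low B (x - h)) by lra.
    rewrite Hz, Rmult_0_r, Rmult_0_r, Rminus_0_r, Rabs_R0. lra.
Qed.

(** The cells cover [[A, B]], because the lattice starts at [sqrt n] and its last cell ends below
    [- sqrt n]. Hence the clamped integrals add up to the whole one, and the errors telescope to [e]
    times the length plus [2 * mesh n * K] for each end point. *)
Lemma sum_interval_error (g g0 : R -> R) (A B K e : R) (n : nat) :
  A <= B -> (0 < n)%nat -> - sqrt (INR n) <= A -> B <= sqrt (INR n) ->
  0 <= e -> (forall y, continuous g0 y) ->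
  (forall y, Rabs (g0 y) <= K) -> (forall y, Rabs (g y) <= K) ->
  (forall y z, A <= y <= B -> Rabs (z - y) <= mesh n -> Rabs (g y - g0 z) <= e) ->
  Rabs (mesh n * sum_f_R0 (fun k => g (pt n k) * indic A B (pt n k)) n - RInt g0 A B)
    <= e * (B - A) + 4 * mesh n * K.
Proof.
  intros HAB Hn HA HB He Hc H0 Hg Hgg.
  pose proof (mesh_pos n Hn) as Hh.
  assert (HK : 0 <= K) by (eapply Rle_trans; [apply Rabs_pos | apply (H0 0)]).
  assert (Hlast : pt n (S n) <= A) by (rewrite pt_S, pt_last by auto; lra).
  assert (Hfirst : B <= pt n 0) by (rewrite pt_0 by auto; lra).
  replace (RInt g0 A B) with
    (sum_f_R0 (fun k => RInt g0 A (clamp A B (pt n k)) - RInt g0 A (clamp A B (pt n (S k)))) n).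
  2:{ rewrite (sum_telescope (fun k => RInt g0 A (clamp A B (pt n k)))).
      rewrite clamp_high, clamp_low by lra.
      rewrite (RInt_point (V := R_CompleteNormedModule)). unfold zero; simpl; ring. }
  rewrite scal_sum, <- minus_sum.
  eapply Rle_trans; [apply (Rsum_abs _ n)|].
  eapply Rle_trans.
  { apply (sum_Rle _ (fun k => e * (clamp A B (pt n k) - clamp A B (pt n (S k))) +
      2 * mesh n * K * (step A (pt n k) - step A (pt n (S k))) +
      2 * mesh n * K * (step B (pt n k) - step B (pt n (S k))))).
    intros k _. rewrite pt_S by auto.
    rewrite (Rmult_comm (g (pt n k) * _)). apply cell_error; auto. }
  rewrite !sum_plus.
  replace (fun k => e * (clamp A B (pt n k) - clamp A B (pt n (S k))))
    with (fun k => (clamp A B (pt n k) - clamp A B (pt n (S k))) * e)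
    by (apply functional_extensionality; intros; ring).
  assert (E : forall D, (fun k => 2 * mesh n * K * (step D (pt n k) - step D (pt n (S k)))) =
    (fun k => (step D (pt n k) - step D (pt n (S k))) * (2 * mesh n * K)))
    by (intros; apply functional_extensionality; intros; ring).
  rewrite !E, <- !scal_sum.
  rewrite (sum_telescope (fun k => clamp A B (pt n k))).
  rewrite (sum_telescope (fun k => step A (pt n k))), (sum_telescope (fun k => step B (pt n k))).
  rewrite (clamp_high A B (pt n 0)), (clamp_low A B (pt n (S n))) by lra.
  assert (HS : forall D, step D (pt n 0) - step D (pt n (S n)) <= 1).
  { intros D. unfold step. destruct (Rlt_dec D _), (Rlt_dec D _); lra. }
  pose proof (HS A). pose proof (HS B).
  assert (0 <= mesh n * K) by nra. nra.
Qed.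

(** * Integrable domination and control of the tails *)

(** The square provides two factors [/ (1 + y ^ 2)]: one has the bounded primitive [atan], the other
    becomes the gain [/ (1 + M ^ 2)] beyond distance [M]. *)
Definition tail_fun (K y : R) : R := K / (1 + y ^ 2) ^ 2.

Lemma one_plus_sqr_ge1 (y : R) : 1 <= 1 + y ^ 2.
Proof. pose proof (pow2_ge_0 y); lra. Qed.

Lemma is_derive_atan_inv (x : R) : is_derive atan x (/ (1 + x ^ 2)).
Proof.
  auto_derive; auto. unfold Rsqr. field. pose proof (one_plus_sqr_neq0 x). lra.
Qed.

Lemma atan_cell (x h : R) : 0 <= h <= 1 -> h / (1 + x ^ 2) <= 3 * (atan x - atan (x - h)).
Proof.
  intros Hh.
  destruct (MVT_gen atan (x - h) x (fun z => / (1 + z ^ 2))) as [c [Hc E]].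
  - intros; apply is_derive_atan_inv.
  - intros. apply continuity_pt_filterlim, continuous_derivable.
    eexists; apply is_derive_atan_inv.
  - rewrite Rmin_left, Rmax_right in Hc by lra. rewrite E.
    replace (x - (x - h)) with h by ring.
    pose proof (one_plus_sqr_ge1 x). pose proof (one_plus_sqr_ge1 c).
    assert ((c - x) ^ 2 <= 1) by nra.
    (* This square equals [2 * x ^ 2 + 2 * (c - x) ^ 2 - c ^ 2], so [c ^ 2 <= 2 * x ^ 2 + 2]; the
       constant 3 comes from here. *)
    pose proof (pow2_ge_0 (2 * x - c)).
    assert (1 + c ^ 2 <= 3 * (1 + x ^ 2)) by lra.
    assert (/ (1 + x ^ 2) <= 3 * / (1 + c ^ 2)).
    { apply Rmult_le_reg_r with ((1 + x ^ 2) * (1 + c ^ 2)); [nra|].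
      field_simplify; lra. }
    unfold Rdiv. nra.
Qed.

(** The cell bounds telescope to three times an increment of [atan], which never exceeds [PI]; this
    makes the bound uniform in [n]. *)
Lemma sum_cauchy_bound (n : nat) : (0 < n)%nat -> mesh n <= 1 ->
  mesh n * sum_f_R0 (fun k => / (1 + pt n k ^ 2)) n <= 3 * PI.
Proof.
  intros Hn Hm. pose proof (mesh_pos n Hn).
  rewrite scal_sum.
  eapply Rle_trans.
  { apply (sum_Rle _ (fun k => (atan (pt n k) - atan (pt n (S k))) * 3)).
    intros k _. rewrite pt_S by auto.
    pose proof (atan_cell (pt n k) (mesh n) ltac:(lra)). unfold Rdiv in *. lra. }
  rewrite <- scal_sum, (sum_telescope (fun k => atan (pt n k))).
  pose proof (atan_bound (pt n 0)). pose proof (atan_bound (pt n (S n))). lra.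
Qed.

Lemma tail_fun_le (K y : R) : 0 <= K -> tail_fun K y <= K * / (1 + y ^ 2).
Proof.
  intros HK. unfold tail_fun, Rdiv. apply Rmult_le_compat_l; auto.
  pose proof (one_plus_sqr_ge1 y). apply Rinv_le_contravar; nra.
Qed.

Lemma tail_fun_le_const (K y : R) : 0 <= K -> tail_fun K y <= K.
Proof.
  intros HK. eapply Rle_trans; [apply tail_fun_le, HK|].
  pose proof (one_plus_sqr_ge1 y).
  rewrite <- (Rmult_1_r K) at 2. apply Rmult_le_compat_l; auto.
  rewrite <- Rinv_1. apply Rinv_le_contravar; lra.
Qed.

Lemma tail_fun_far (K M y : R) : 0 <= K -> 0 <= M -> M <= Rabs y ->
  tail_fun K y <= K / (1 + M ^ 2) * / (1 + y ^ 2).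
Proof.
  intros HK HM Hy.
  assert (Hy2 : M ^ 2 <= y ^ 2) by (rewrite <- (pow2_abs y); apply pow_incr; lra).
  pose proof (one_plus_sqr_ge1 y). pose proof (one_plus_sqr_ge1 M).
  unfold tail_fun, Rdiv. rewrite Rmult_assoc. apply Rmult_le_compat_l; auto.
  rewrite <- Rinv_mult. apply Rinv_le_contravar; nra.
Qed.

Lemma tail_fun_dominates_ge0 (g : R -> R) (K : R) :
  (forall y, Rabs (g y) <= tail_fun K y) -> 0 <= K.
Proof.
  intros H. pose proof (Rle_trans _ _ _ (Rabs_pos _) (H 0)) as H0.
  unfold tail_fun in H0. replace (K / (1 + 0 ^ 2) ^ 2) with K in H0 by field. exact H0.
Qed.

(* [None] stands for the upper end point [+oo]. *)
Definition cut (o : option R) (x : R) : R :=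
  match o with
  | None => 1
  | Some a => if Rle_dec x a then 1 else 0
  end.

Definition upper (o : option R) (M : R) : R :=
  match o with None => M | Some a => a end.

Definition beyond (o : option R) (M : R) : Prop :=
  0 <= M /\ match o with None => True | Some a => Rabs a <= M end.

Lemma beyond_eventually (o : option R) : exists M0, forall M, M0 <= M -> beyond o M.
Proof.
  destruct o as [a|].
  - exists (Rabs a). intros M HM. pose proof (Rabs_pos a). split; lra.
  - exists 0. intros M HM. split; auto.
Qed.

Lemma beyond_upper (o : option R) (M : R) : beyond o M -> - M <= upper o M <= M.
Proof.
  destruct o as [a|]; intros [H1 H2]; simpl; [|lra].
  apply Rabs_le_between in H2. lra.
Qed.

Lemma beyond_mono (o : option R) (M M' : R) : beyond o M -> M <= M' -> beyond o M'.
Proof. destruct o; intros [H1 H2] H; split; auto; lra. Qed.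

Definition lsum (n : nat) (o : option R) (g : R -> R) : R :=
  mesh n * sum_f_R0 (fun k => g (pt n k) * cut o (pt n k)) n.

Lemma cut_range (o : option R) (x : R) : 0 <= cut o x <= 1.
Proof. unfold cut. destruct o as [a|]; [destruct (Rle_dec x a)|]; lra. Qed.

Lemma lsum_bound (n : nat) (o : option R) (g : R -> R) (K : R) :
  (0 < n)%nat -> mesh n <= 1 -> (forall y, Rabs (g y) <= tail_fun K y) ->
  Rabs (lsum n o g) <= K * (3 * PI).
Proof.
  intros Hn Hm Hg. pose proof (mesh_pos n Hn) as Hh.
  pose proof (tail_fun_dominates_ge0 g K Hg) as HK.
  unfold lsum. rewrite Rabs_mult, (Rabs_pos_eq (mesh n)) by lra.
  eapply Rle_trans; [apply Rmult_le_compat_l; [lra|apply Rsum_abs]|].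
  eapply Rle_trans.
  { apply Rmult_le_compat_l; [lra|].
    apply (sum_Rle _ (fun k => / (1 + pt n k ^ 2) * K)). intros k _.
    rewrite Rabs_mult. pose proof (cut_range o (pt n k)).
    rewrite (Rabs_pos_eq (cut o _)) by lra.
    pose proof (Hg (pt n k)). pose proof (tail_fun_le K (pt n k) HK).
    pose proof (Rabs_pos (g (pt n k))). nra. }
  rewrite <- scal_sum. pose proof (sum_cauchy_bound n Hn Hm). nra.
Qed.

(** The weights [cut] and [indic] differ only at points with [M <= Rabs x], the excluded end point
    [- M] among them. There [tail_fun_far] leaves a summable factor. *)
Lemma lsum_truncate (n : nat) (o : option R) (g : R -> R) (K M : R) :
  (0 < n)%nat -> mesh n <= 1 -> (forall y, Rabs (g y) <= tail_fun K y) -> beyond o M ->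
  Rabs (lsum n o g - mesh n * sum_f_R0 (fun k => g (pt n k) * indic (- M) (upper o M) (pt n k)) n)
    <= K / (1 + M ^ 2) * (3 * PI).
Proof.
  intros Hn Hm Hg HM. pose proof (mesh_pos n Hn) as Hh.
  pose proof (tail_fun_dominates_ge0 g K Hg) as HK.
  pose proof (beyond_upper o M HM) as Hu.
  unfold lsum. rewrite <- Rmult_minus_distr_l, <- minus_sum.
  rewrite Rabs_mult, (Rabs_pos_eq (mesh n)) by lra.
  eapply Rle_trans; [apply Rmult_le_compat_l; [lra|apply Rsum_abs]|].
  assert (HK' : 0 <= K / (1 + M ^ 2)).
  { pose proof (one_plus_sqr_ge1 M). apply Rdiv_le_0_compat; lra. }
  eapply Rle_trans.
  { apply Rmult_le_compat_l; [lra|].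
    apply (sum_Rle _ (fun k => / (1 + pt n k ^ 2) * (K / (1 + M ^ 2)))). intros k _.
    set (x := pt n k).
    assert (Hp : 0 <= / (1 + x ^ 2) * (K / (1 + M ^ 2))).
    { apply Rmult_le_pos; auto. apply Rlt_le, Rinv_0_lt_compat.
      pose proof (one_plus_sqr_ge1 x); lra. }
    assert (Hc : cut o x = indic (- M) (upper o M) x \/
                 (M <= Rabs x /\ Rabs (cut o x - indic (- M) (upper o M) x) <= 1)).
    { destruct HM as [HM0 HM1].
      assert (Hi : 0 <= indic (- M) (upper o M) x <= 1).
      { unfold indic. destruct (Rlt_dec _ _); [destruct (Rle_dec _ _)|]; lra. }
      assert (Ha : Rabs (cut o x - indic (- M) (upper o M) x) <= 1).
      { pose proof (cut_range o x). apply Rabs_le; lra. }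
      unfold indic at 1. destruct (Rlt_dec (- M) x) as [H1|H1].
      - destruct (Rle_dec x (upper o M)) as [H2|H2].
        + left. destruct o as [a|]; simpl in *; auto. destruct (Rle_dec x a); lra.
        + destruct o as [a|]; simpl in *.
          * left. destruct (Rle_dec x a); lra.
          * right. split; auto. rewrite Rabs_pos_eq; lra.
      - right. split; auto. rewrite Rabs_left1; lra. }
    rewrite <- Rmult_minus_distr_l.
    destruct Hc as [->|[Hfar Hc]].
    - rewrite Rminus_diag, Rmult_0_r, Rabs_R0. exact Hp.
    - rewrite Rabs_mult. pose proof (Hg x). pose proof (tail_fun_far K M x HK (proj1 HM) Hfar).
      pose proof (Rabs_pos (g x)). nra. }
  rewrite <- scal_sum. pose proof (sum_cauchy_bound n Hn Hm). nra.
Qed.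

Lemma RInt_far_bound (g : R -> R) (K M u v : R) :
  0 <= M -> (forall y, continuous g y) -> (forall y, Rabs (g y) <= tail_fun K y) ->
  u <= v -> (forall y, u <= y <= v -> M <= Rabs y) ->
  Rabs (RInt g u v) <= K / (1 + M ^ 2) * PI.
Proof.
  intros HM Hc Hg Huv Hfar.
  pose proof (tail_fun_dominates_ge0 g K Hg) as HK.
  assert (HK' : 0 <= K / (1 + M ^ 2)).
  { pose proof (one_plus_sqr_ge1 M). apply Rdiv_le_0_compat; lra. }
  apply Rle_trans with (K / (1 + M ^ 2) * (atan v - atan u)).
  - apply (norm_RInt_le (V := R_NormedModule) g
      (fun y => K / (1 + M ^ 2) * / (1 + y ^ 2)) u v); auto.
    + intros y Hy. eapply Rle_trans; [apply Hg|]. apply tail_fun_far; auto.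
    + apply (RInt_correct g u v), ex_RInt_everywhere, Hc.
    + apply (is_RInt_scal (V := R_NormedModule) (fun y => / (1 + y ^ 2)) u v (K / (1 + M ^ 2)) (atan v - atan u)).
      apply (is_RInt_derive (V := R_CompleteNormedModule) atan (fun y => / (1 + y ^ 2))).
      * intros; apply is_derive_atan_inv.
      * intros. apply continuous_derivable. auto_derive. apply one_plus_sqr_neq0.
  - pose proof (atan_bound u). pose proof (atan_bound v). nra.
Qed.

Lemma RInt_box_cauchy (g : R -> R) (o : option R) (K M M' : R) :
  (forall y, continuous g y) -> (forall y, Rabs (g y) <= tail_fun K y) ->
  beyond o M -> M <= M' ->
  Rabs (RInt g (- M) (upper o M) - RInt g (- M') (upper o M')) <= K / (1 + M ^ 2) * (2 * PI).
Proof.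
  intros Hc Hg HM HM'. pose proof (proj1 HM) as HM0.
  pose proof (beyond_upper o M HM) as Hu.
  pose proof (beyond_upper o M' (beyond_mono o M M' HM HM')) as Hu'.
  assert (Hle : upper o M <= upper o M') by (destruct o; simpl; lra).
  rewrite (RInt_split g (- M') (- M) (upper o M')) by exact Hc.
  rewrite (RInt_split g (- M) (upper o M) (upper o M')) by exact Hc.
  assert (H1 : Rabs (RInt g (- M') (- M)) <= K / (1 + M ^ 2) * PI).
  { apply RInt_far_bound; auto; [lra|]. intros y Hy. rewrite Rabs_left1; lra. }
  assert (H2 : Rabs (RInt g (upper o M) (upper o M')) <= K / (1 + M ^ 2) * PI).
  { destruct o as [a|]; simpl in *.
    - rewrite (RInt_point (V := R_CompleteNormedModule)). unfold zero; simpl. rewrite Rabs_R0.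
      pose proof (tail_fun_dominates_ge0 g K Hg). pose proof PI_RGT_0.
      pose proof (one_plus_sqr_ge1 M). apply Rmult_le_pos; [apply Rdiv_le_0_compat; lra|lra].
    - apply RInt_far_bound; auto. intros y Hy. rewrite Rabs_pos_eq; lra. }
  match goal with |- Rabs ?e <= _ =>
    replace e with (- (RInt g (- M') (- M) + RInt g (upper o M) (upper o M'))) by ring end.
  rewrite Rabs_Ropp. eapply Rle_trans; [apply Rabs_triang|].
  replace (K / (1 + M ^ 2) * (2 * PI)) with (K / (1 + M ^ 2) * PI + K / (1 + M ^ 2) * PI) by ring.
  apply Rplus_le_compat; auto.
Qed.

(** * Improper integrals and convergence of dominated lattice sums *)

(** A total function: [impint_is_lim] shows that the limit exists when [g] is continuous and lies
    under a [tail_fun]. For [None] both ends of the window move, which under such a bound still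
    gives the usual integral over the line. *)
Definition impint (o : option R) (g : R -> R) : R :=
  real (Lim (fun M => RInt g (- M) (upper o M)) p_infty).

Lemma const_over_sqr_small (C eps : R) : 0 <= C -> 0 < eps ->
  exists M0, 0 <= M0 /\ forall M, M0 <= M -> C / (1 + M ^ 2) < eps.
Proof.
  intros HC He. exists (C / eps + 1).
  assert (0 <= C / eps) by (apply Rdiv_le_0_compat; lra).
  split; [lra|]. intros M HM.
  apply Rmult_lt_reg_r with (1 + M ^ 2); [nra|].
  unfold Rdiv. rewrite Rmult_assoc, Rinv_l, Rmult_1_r by nra.
  assert (C / eps < 1 + M ^ 2) by nra.
  apply Rmult_lt_compat_l with (r := eps) in H0; auto.
  replace (eps * (C / eps)) with C in H0 by (field; lra). lra.
Qed.

Lemma impint_is_lim (g : R -> R) (o : option R) (K : R) :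
  (forall y, continuous g y) -> (forall y, Rabs (g y) <= tail_fun K y) ->
  is_lim (fun M => RInt g (- M) (upper o M)) p_infty (impint o g).
Proof.
  intros Hc Hg. pose proof (tail_fun_dominates_ge0 g K Hg) as HK. pose proof PI_RGT_0 as Hpi.
  assert (Hex : exists l : R, filterlim (fun M => RInt g (- M) (upper o M))
      (Rbar_locally' p_infty) (locally l)).
  { apply (filterlim_locally_cauchy (U := R_CompleteSpace)
      (fun M => RInt g (- M) (upper o M))).
    intros eps.
    destruct (beyond_eventually o) as [M1 HM1].
    destruct (const_over_sqr_small (K * (2 * PI)) (eps / 2)) as [M2 [_ HM2]].
    { nra. } { pose proof (cond_pos eps); lra. }
    set (M0 := Rmax M1 M2).
    assert (HM0 : M1 <= M0 /\ M2 <= M0) by (split; [apply Rmax_l|apply Rmax_r]).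
    exists (fun M => M0 < M). split; [exists M0; auto|].
    intros u v Hu Hv.
    assert (B : forall w, M0 < w ->
      Rabs (RInt g (- M0) (upper o M0) - RInt g (- w) (upper o w)) < eps / 2).
    { intros w Hw. eapply Rle_lt_trans.
      apply RInt_box_cauchy with (K := K); auto; [apply HM1; lra | lra].
      replace (K / (1 + M0 ^ 2) * (2 * PI)) with (K * (2 * PI) / (1 + M0 ^ 2))
        by (unfold Rdiv; ring). apply HM2; lra. }
    pose proof (B u Hu) as Bu. pose proof (B v Hv) as Bv.
    change (Rabs (RInt g (- v) (upper o v) - RInt g (- u) (upper o u)) < eps).
    replace (RInt g (- v) (upper o v) - RInt g (- u) (upper o u)) with
      ((RInt g (- M0) (upper o M0) - RInt g (- u) (upper o u)) -
       (RInt g (- M0) (upper o M0) - RInt g (- v) (upper o v))) by ring.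
    eapply Rle_lt_trans; [apply Rabs_triang|]. rewrite Rabs_Ropp. lra. }
  destruct Hex as [l Hl].
  assert (Hl' : is_lim (fun M => RInt g (- M) (upper o M)) p_infty l) by exact Hl.
  unfold impint. rewrite (is_lim_unique _ _ _ Hl'). exact Hl'.
Qed.

Lemma impint_tail (g : R -> R) (o : option R) (K M : R) :
  (forall y, continuous g y) -> (forall y, Rabs (g y) <= tail_fun K y) -> beyond o M ->
  Rabs (RInt g (- M) (upper o M) - impint o g) <= K / (1 + M ^ 2) * (2 * PI).
Proof.
  intros Hc Hg HM. apply le_epsilon. intros eps He.
  pose proof (proj2 (is_lim_spec _ _ _) (impint_is_lim g o K Hc Hg) (mkposreal eps He)) as [M1 HM1].
  simpl in HM1. set (M' := Rmax M (M1 + 1)).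
  assert (M <= M') by apply Rmax_l. assert (M1 + 1 <= M') by apply Rmax_r.
  specialize (HM1 M' ltac:(lra)).
  pose proof (RInt_box_cauchy g o K M M' Hc Hg HM H).
  replace (RInt g (- M) (upper o M) - impint o g) with
   ((RInt g (- M) (upper o M) - RInt g (- M') (upper o M')) +
    (RInt g (- M') (upper o M') - impint o g)) by ring.
  eapply Rle_trans; [apply Rabs_triang|]. lra.
Qed.

Lemma limit_along_dominated {T : Type} (F : (T -> Prop) -> Prop) {FF : ProperFilter F}
    (g : T -> R -> R) (g0 : R -> R) (K : R) :
  (forall y, filterlim (fun p : T * R => g (fst p) (snd p))
               (filter_prod F (locally y)) (locally (g0 y))) ->
  F (fun t => forall y, Rabs (g t y) <= tail_fun K y) ->
  forall y, Rabs (g0 y) <= tail_fun K y.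
Proof.
  intros H HF y. apply le_epsilon. intros eps He.
  pose proof (proj1 (filterlim_locally _ _) (H y) (mkposreal eps He)) as [Q P HQ HP HQP].
  destruct (filter_ex _ (filter_and _ _ HQ HF)) as [t [Ht Ht']].
  specialize (HQP t y Ht (locally_singleton _ _ HP)). specialize (Ht' y).
  change (Rabs (g t y - g0 y) < eps) in HQP.
  replace (g0 y) with (g t y - (g t y - g0 y)) by ring.
  eapply Rle_trans; [apply Rabs_triang|]. rewrite Rabs_Ropp. lra.
Qed.

(** Dominated convergence for lattice sums. The window [M] depends only on [K], [o] and [eps], so it
    is fixed before the index moves; inside it, uniform convergence and the shrinking mesh do the
    rest. *)
Theorem lsum_cv {T : Type} (F : (T -> Prop) -> Prop) {FF : ProperFilter F}
    (n : T -> nat) (g : T -> R -> R) (g0 : R -> R) (K : R) (o : option R) :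
  filterlim n F eventually ->
  (forall y, filterlim (fun p : T * R => g (fst p) (snd p))
               (filter_prod F (locally y)) (locally (g0 y))) ->
  F (fun t => forall y, Rabs (g t y) <= tail_fun K y) ->
  filterlim (fun t => lsum (n t) o (g t)) F (locally (impint o g0)).
Proof.
  intros Hn H HF.
  pose proof (limit_along_continuous F g g0 H) as Hc.
  pose proof (limit_along_dominated F g g0 K H HF) as Hg0.
  pose proof (tail_fun_dominates_ge0 g0 K Hg0) as HK. pose proof PI_RGT_0 as Hpi.
  apply filterlim_locally. intros [eps He].
  destruct (beyond_eventually o) as [M1 HM1].
  (* Four errors of at most [eps / 5] each: the tail of the sum, the oscillation inside cells, the
     cells at the end points, and the tail of the integral, whose constant [2 * PI] is below
     [3 * PI]. *)
  destruct (const_over_sqr_small (K * (3 * PI)) (eps / 5)) as [M2 [HM20 HM2]]; [nra|lra|].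
  set (M := Rmax M1 M2).
  assert (HM : M1 <= M /\ M2 <= M) by (split; [apply Rmax_l|apply Rmax_r]).
  assert (HbM : beyond o M) by (apply HM1; lra).
  specialize (HM2 M (proj2 HM)).
  pose proof (beyond_upper o M HbM) as Hu.
  (* The window has length at most [2 * M]; the [+ 1] keeps the divisor positive when [M = 0]. *)
  set (e := eps / 5 / (2 * M + 1)).
  assert (HMp : 0 <= M) by lra.
  assert (Hepos : 0 < e) by (apply Rdiv_lt_0_compat; lra).
  assert (HeM : e * (upper o M - - M) <= eps / 5).
  { apply Rle_trans with (e * (2 * M + 1)); [nra|]. right. unfold e. field. lra. }
  destruct (limit_along_uniform F g g0 (- M) (upper o M) e H Hc Hepos) as [d [Hd Hunif]].
  destruct (mesh_small (Rmin (Rmin 1 d) (eps / 5 / (4 * K + 1)))) as [n1 Hn1].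
  { repeat apply Rmin_glb_lt; try lra. apply Rdiv_lt_0_compat; lra. }
  destruct (sqrt_INR_large M) as [n2 Hn2].
  assert (HFn : F (fun t => (n1 <= n t)%nat /\ (n2 <= n t)%nat)).
  { apply filter_and.
    - apply (Hn (fun k => (n1 <= k)%nat)). exists n1. auto.
    - apply (Hn (fun k => (n2 <= k)%nat)). exists n2. auto. }
  generalize (filter_and _ _ HFn (filter_and _ _ Hunif HF)).
  apply filter_imp. intros t [[Ht1 Ht2] [Htu Htd]].
  destruct (Hn1 _ Ht1) as [Hnt Hmesh]. specialize (Hn2 _ Ht2).
  pose proof (mesh_pos _ Hnt) as Hmp.
  assert (Hm1 : mesh (n t) < 1 /\ mesh (n t) < d /\ mesh (n t) < eps / 5 / (4 * K + 1)).
  { pose proof (Rmin_l (Rmin 1 d) (eps / 5 / (4 * K + 1))).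
    pose proof (Rmin_r (Rmin 1 d) (eps / 5 / (4 * K + 1))).
    pose proof (Rmin_l 1 d). pose proof (Rmin_r 1 d). lra. }
  destruct Hm1 as [Hm1 [Hmd HmK]].
  assert (HmK' : 4 * mesh (n t) * K <= eps / 5).
  { apply Rle_trans with (mesh (n t) * (4 * K + 1)); [nra|].
    apply Rle_trans with (eps / 5 / (4 * K + 1) * (4 * K + 1)).
    - apply Rmult_le_compat_r; lra.
    - right. field. lra. }
  pose proof (lsum_truncate (n t) o (g t) K M Hnt ltac:(lra) Htd HbM) as E1.
  pose proof (sum_interval_error (g t) g0 (- M) (upper o M) K e (n t)) as E2.
  pose proof (impint_tail g0 o K M Hc Hg0 HbM) as E3.
  assert (E2' := E2 ltac:(lra) Hnt ltac:(lra) ltac:(lra) ltac:(lra) Hc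
    (fun y => Rle_trans _ _ _ (Hg0 y) (tail_fun_le_const K y HK))
    (fun y => Rle_trans _ _ _ (Htd y) (tail_fun_le_const K y HK))
    (fun y z Hy Hz => Rlt_le _ _ (Htu y z Hy (Rle_lt_trans _ _ _ Hz Hmd)))).
  clear E2.
  assert (HKM : 0 <= K / (1 + M ^ 2)).
  { pose proof (one_plus_sqr_ge1 M). apply Rdiv_le_0_compat; lra. }
  replace (K * (3 * PI) / (1 + M ^ 2)) with (K / (1 + M ^ 2) * (3 * PI)) in HM2
    by (unfold Rdiv; ring).
  change (Rabs (lsum (n t) o (g t) - impint o g0) < eps).
  set (S1 := lsum (n t) o (g t)) in *.
  set (S2 := mesh (n t) * sum_f_R0 _ _) in *.
  replace (S1 - impint o g0) with ((S1 - S2) + (S2 - RInt g0 (- M) (upper o M)) +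
    (RInt g0 (- M) (upper o M) - impint o g0)) by ring.
  eapply Rle_lt_trans; [apply Rabs_triang|].
  pose proof (Rabs_triang (S1 - S2) (S2 - RInt g0 (- M) (upper o M))). nra.
Qed.

(** * Local limit theorem for binomial coefficients *)

Lemma exp_le_mono (x y : R) : x <= y -> exp x <= exp y.
Proof. intros [H| ->]; [apply Rlt_le, exp_increasing, H | lra]. Qed.

(** This is [atanh u >= u] without logarithms: [(1 + v) * exp (- v) - (1 - v) * exp v] vanishes at 0
    and has derivative [v * (exp v - exp (- v)) >= 0]. *)
Lemma log_ratio_lower (u : R) : 0 <= u < 1 -> 1 <= (1 + u) / (1 - u) * exp (- 2 * u).
Proof.
  intros Hu.
  destruct (MVT_gen (fun v => (1 + v) * exp (- v) - (1 - v) * exp v) 0 u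
    (fun v => v * (exp v - exp (- v)))) as [c [Hc E]].
  - intros v _. auto_derive; auto. ring.
  - intros v _. apply continuity_pt_filterlim.
    apply (continuous_derivable (fun v => (1 + v) * exp (- v) - (1 - v) * exp v)).
    auto_derive; auto.
  - rewrite Rmin_left, Rmax_right in Hc by lra.
    rewrite Ropp_0, exp_0 in E.
    assert (0 <= c * (exp c - exp (- c)) * (u - 0)).
    { pose proof (exp_le_mono (- c) c ltac:(lra)).
      apply Rmult_le_pos; [apply Rmult_le_pos|]; lra. }
    assert (H1 : (1 - u) * exp u <= (1 + u) * exp (- u)) by lra.
    replace (- 2 * u) with (- u + - u) by ring. rewrite exp_plus.
    apply Rmult_le_reg_r with ((1 - u) * exp u).
    + apply Rmult_lt_0_compat; [lra|apply exp_pos].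
    + replace ((1 + u) / (1 - u) * (exp (- u) * exp (- u)) * ((1 - u) * exp u))
        with ((1 + u) * exp (- u) * (exp (- u) * exp u)) by (field; lra).
      rewrite <- exp_plus, Rplus_opp_l, exp_0. lra.
Qed.

(** From [1 + t <= exp t] with [t = 2 * u / (1 - u)]. The true exponent is of order [u ^ 3], but
    [u ^ 2] suffices: about [sqrt n] steps with [u] of order [/ sqrt n] lose only order
    [/ sqrt n]. *)
Lemma log_ratio_upper (u : R) : 0 <= u <= 1 / 2 ->
  (1 + u) / (1 - u) * exp (- 2 * u) <= exp (4 * u ^ 2).
Proof.
  intros Hu.
  apply Rle_trans with (exp (2 * u / (1 - u)) * exp (- 2 * u)).
  - apply Rmult_le_compat_r; [apply Rlt_le, exp_pos|].
    replace ((1 + u) / (1 - u)) with (1 + 2 * u / (1 - u)) by (field; lra).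
    apply exp_ineq1_le.
  - rewrite <- exp_plus. apply exp_le_mono.
    replace (2 * u / (1 - u) + - 2 * u) with (2 * u ^ 2 * / (1 - u)) by (field; lra).
    replace (4 * u ^ 2) with (2 * u ^ 2 * 2) by ring.
    apply Rmult_le_compat_l; [pose proof (pow2_ge_0 u); lra|].
    replace 2 with (/ (1 / 2)) by field. apply Rinv_le_contravar; lra.
Qed.

Definition mag (n k : nat) : R := INR n - 2 * INR k.

(* The correction [n + 1] (instead of [n]) makes the quotient of consecutive
   values exactly [(1 + u) / (1 - u) * exp (- 2 u)] with
   [u = (n - 2 k - 1) / (n + 1)]: the normalised coefficients are unimodal. *)
Definition nbin (n k : nat) : R :=
  Binomial.C n k * exp (mag n k ^ 2 / (2 * (INR n + 1))).

Lemma binom_pos (n k : nat) : 0 < Binomial.C n k.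
Proof.
  unfold Binomial.C. apply Rdiv_lt_0_compat; [|apply Rmult_lt_0_compat];
  apply INR_fact_lt_0.
Qed.

Lemma nbin_pos (n k : nat) : 0 < nbin n k.
Proof. apply Rmult_lt_0_compat; [apply binom_pos|apply exp_pos]. Qed.

Lemma nbin_step (n i : nat) : (S i <= n)%nat ->
  let u := (mag n i - 1) / (INR n + 1) in
  nbin n (S i) = nbin n i * ((1 + u) / (1 - u) * exp (- 2 * u)).
Proof.
  intros Hi u. unfold nbin. rewrite pascal_step3 by lia.
  pose proof (pos_INR n). pose proof (pos_INR i).
  assert (Hu : (1 + u) / (1 - u) = INR (n - i) / INR (S i)).
  { unfold u, mag. rewrite minus_INR, S_INR by lia. field. lra. }
  rewrite Hu.
  replace (mag n (S i) ^ 2 / (2 * (INR n + 1))) with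
    (mag n i ^ 2 / (2 * (INR n + 1)) + - 2 * u).
  - rewrite exp_plus. ring.
  - unfold u, mag. rewrite S_INR. field. lra.
Qed.

Lemma nbin_step_bounds (n i : nat) : (2 * S i <= n)%nat ->
  nbin n i <= nbin n (S i) /\
  (mag n i / (INR n + 1) <= 1 / 2 ->
   nbin n (S i) <= nbin n i * exp (4 * (mag n i / (INR n + 1)) ^ 2)).
Proof.
  intros Hi. rewrite nbin_step by lia. pose proof (nbin_pos n i) as Hp.
  set (u := (mag n i - 1) / (INR n + 1)).
  pose proof (pos_INR n) as Hn. pose proof (pos_INR i) as Hi0.
  assert (HS : 2 * (INR i + 1) <= INR n).
  { rewrite <- S_INR. replace 2 with (INR 2) by (simpl; lra).
    rewrite <- mult_INR. apply le_INR, Hi. }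
  assert (Hu0 : 0 <= u) by (apply Rdiv_le_0_compat; unfold mag; lra).
  assert (Hu1 : u < 1).
  { apply Rmult_lt_reg_r with (INR n + 1); [lra|]. unfold u, Rdiv.
    rewrite Rmult_assoc, Rinv_l by lra. unfold mag. lra. }
  assert (HuU : u <= mag n i / (INR n + 1)).
  { apply Rmult_le_compat_r; [apply Rlt_le, Rinv_0_lt_compat; lra|lra]. }
  split.
  - rewrite <- (Rmult_1_r (nbin n i)) at 1. apply Rmult_le_compat_l; [lra|].
    apply log_ratio_lower; lra.
  - intros HU. apply Rmult_le_compat_l; [lra|].
    eapply Rle_trans; [apply log_ratio_upper; lra|]. apply exp_le_mono.
    apply Rmult_le_compat_l; [lra|]. apply pow_incr; lra.
Qed.

Lemma nbin_increasing (n k j : nat) : (k <= j)%nat -> (2 * j <= n)%nat -> nbin n k <= nbin n j.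
Proof.
  intros Hkj. induction Hkj as [|j Hkj IH]; intros Hj; [lra|].
  eapply Rle_trans; [apply IH; lia|]. apply nbin_step_bounds, Hj.
Qed.

(** The magnetisation decreases towards the centre, so each of the [j - k] steps gains at most the
    factor allowed at the starting point [k]. *)
Lemma nbin_growth (n k j : nat) : (k <= j)%nat -> (2 * j <= n)%nat ->
  mag n k / (INR n + 1) <= 1 / 2 ->
  nbin n j <= nbin n k * exp (INR (j - k) * (4 * (mag n k / (INR n + 1)) ^ 2)).
Proof.
  intros Hkj Hj HU. revert Hj. induction Hkj as [|j Hkj IH]; intros Hj.
  - rewrite Nat.sub_diag, Rmult_0_l, exp_0. lra.
  - replace (S j - k)%nat with (S (j - k)) by lia.
    rewrite S_INR, Rmult_plus_distr_r, exp_plus, Rmult_1_l, <- Rmult_assoc.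
    pose proof (pos_INR n) as Hn.
    assert (Hmag : 0 <= mag n j <= mag n k).
    { unfold mag. apply le_INR in Hkj. split; [|lra].
      assert (HS : (2 * j <= n)%nat) by lia. apply le_INR in HS.
      rewrite mult_INR in HS. simpl (INR 2) in HS. lra. }
    assert (Hinv : 0 < / (INR n + 1)) by (apply Rinv_0_lt_compat; lra).
    assert (HUj : 0 <= mag n j / (INR n + 1) <= mag n k / (INR n + 1)).
    { unfold Rdiv. split; [apply Rmult_le_pos|apply Rmult_le_compat_r]; lra. }
    eapply Rle_trans; [apply nbin_step_bounds; [lia|lra]|].
    apply Rmult_le_compat.
    + apply Rlt_le, nbin_pos.
    + apply Rlt_le, exp_pos.
    + apply IH; lia.
    + apply exp_le_mono, Rmult_le_compat_l; [lra|]. apply pow_incr; lra.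
Qed.

Lemma mag_sym (n k : nat) : (k <= n)%nat -> mag n (n - k) = - mag n k.
Proof. intros Hk. unfold mag. rewrite minus_INR by auto. ring. Qed.

Lemma nbin_sym (n k : nat) : (k <= n)%nat -> nbin n (n - k) = nbin n k.
Proof.
  intros Hk. unfold nbin. rewrite <- pascal_step1 by auto. rewrite mag_sym by auto.
  f_equal. f_equal. f_equal. ring.
Qed.

(** Here [mag] is 0 or 1 according to parity. Keeping the exponential factor in the odd case makes
    this the exact maximum of [nbin n]. *)
Definition peak (n : nat) : R := nbin n (Nat.div2 n).

Lemma peak_pos (n : nat) : 0 < peak n.
Proof. apply nbin_pos. Qed.

Lemma div2_spec (n : nat) : (2 * Nat.div2 n <= n <= 2 * Nat.div2 n + 1)%nat.
Proof. pose proof (Nat.div2_odd n). destruct (Nat.odd n); simpl in *; lia. Qed.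

Lemma nbin_le_peak (n k : nat) : (k <= n)%nat -> nbin n k <= peak n.
Proof.
  intros Hk. pose proof (div2_spec n) as Hd.
  destruct (le_lt_dec k (Nat.div2 n)).
  - apply nbin_increasing; lia.
  - rewrite <- nbin_sym by auto. apply nbin_increasing; lia.
Qed.

(** At most [mag n k / 2] steps separate [k] from the centre, and each gains at most
    [4 * (mag n k / (n + 1)) ^ 2] in the exponent. Reflection [k -> n - k] covers the other half. *)
Lemma peak_le_nbin (n k : nat) : (k <= n)%nat ->
  Rabs (mag n k) / (INR n + 1) <= 1 / 2 ->
  peak n <= nbin n k * exp (2 * Rabs (mag n k) ^ 3 / (INR n + 1) ^ 2).
Proof.
  assert (Hlow : forall i, (i <= Nat.div2 n)%nat -> mag n i / (INR n + 1) <= 1 / 2 ->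
    0 <= mag n i /\ peak n <= nbin n i * exp (2 * mag n i ^ 3 / (INR n + 1) ^ 2)).
  { intros i Hi Hm. pose proof (div2_spec n) as Hd. pose proof (pos_INR n).
    assert (Hs : 2 * INR (Nat.div2 n - i) <= mag n i).
    { rewrite minus_INR by auto. destruct Hd as [Hd _]. apply le_INR in Hd.
      rewrite mult_INR in Hd. simpl (INR 2) in Hd. unfold mag. lra. }
    pose proof (pos_INR (Nat.div2 n - i)).
    split; [lra|].
    eapply Rle_trans; [apply nbin_growth with (k := i); [exact Hi|lia|exact Hm]|].
    apply Rmult_le_compat_l; [apply Rlt_le, nbin_pos|]. apply exp_le_mono.
    replace (2 * mag n i ^ 3 / (INR n + 1) ^ 2) with
      (mag n i / 2 * (4 * (mag n i / (INR n + 1)) ^ 2)) by (field; lra).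
    apply Rmult_le_compat_r; [pose proof (pow2_ge_0 (mag n i / (INR n + 1))); lra|lra]. }
  intros Hk Hm.
  destruct (le_lt_dec k (Nat.div2 n)) as [H|H].
  - destruct (Hlow k H) as [H1 H2].
    + eapply Rle_trans; [|exact Hm]. apply Rmult_le_compat_r; [|apply Rle_abs].
      pose proof (pos_INR n). apply Rlt_le, Rinv_0_lt_compat; lra.
    + rewrite (Rabs_pos_eq (mag n k)) by lra. exact H2.
  - pose proof (div2_spec n) as Hd.
    assert (Ha : Rabs (mag n k) = mag n (n - k)).
    { rewrite mag_sym by auto. apply Rabs_left1. unfold mag.
      assert (HS : (n <= 2 * k)%nat) by lia. apply le_INR in HS.
      rewrite mult_INR in HS. simpl (INR 2) in HS. lra. }
    rewrite Ha in *. rewrite <- nbin_sym by auto.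
    apply Hlow; [lia|exact Hm].
Qed.

(* Only the values on the lattice matter; off the lattice we take the limit. *)
Definition bdens (n : nat) (x : R) : R :=
  match excluded_middle_informative (exists k, (k <= n)%nat /\ x = pt n k) with
  | left H => Binomial.C n (proj1_sig (constructive_indefinite_description _ H)) / peak n
  | right _ => exp (- x ^ 2 / 2)
  end.

Lemma pt_mag (n k : nat) : pt n k = mag n k / sqrt (INR n).
Proof. reflexivity. Qed.

Lemma pt_inj (n k l : nat) : (0 < n)%nat -> pt n k = pt n l -> k = l.
Proof.
  intros Hn H. pose proof (sqrt_INR_pos n Hn) as Hs. apply INR_eq.
  unfold pt, Rdiv in H. apply Rmult_eq_reg_r in H; [lra|].
  apply Rinv_neq_0_compat; lra.
Qed.

Lemma bdens_pt (n k : nat) : (0 < n)%nat -> (k <= n)%nat ->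
  bdens n (pt n k) = Binomial.C n k / peak n.
Proof.
  intros Hn Hk. unfold bdens.
  destruct (excluded_middle_informative _) as [H|H].
  - destruct (constructive_indefinite_description _ H) as [l [Hl E]]. simpl.
    apply pt_inj in E; auto. subst. reflexivity.
  - exfalso. apply H. exists k. auto.
Qed.

Lemma bdens_cases (n : nat) (x : R) : (0 < n)%nat ->
  (exists k, (k <= n)%nat /\ x = pt n k /\ bdens n x = Binomial.C n k / peak n) \/
  bdens n x = exp (- x ^ 2 / 2).
Proof.
  intros Hn. destruct (classic (exists k, (k <= n)%nat /\ x = pt n k)) as [[k [Hk ->]]|H].
  - left. exists k. repeat split; auto. apply bdens_pt; auto.
  - right. unfold bdens. destruct (excluded_middle_informative _); tauto.
Qed.

(** Translates the denominator [n + 1] of [nbin] to the scale of [pt]: [mag n k ^ 2 / (n + 1) = pt n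
    k ^ 2 * shrink n]. *)
Definition shrink (n : nat) : R := INR n / (INR n + 1).

Lemma binom_nbin (n k : nat) : (0 < n)%nat ->
  Binomial.C n k = nbin n k * exp (- pt n k ^ 2 / 2 * shrink n).
Proof.
  intros Hn. pose proof (sqrt_INR_pos n Hn) as Hs. pose proof (pos_INR n).
  unfold nbin. rewrite Rmult_assoc, <- exp_plus.
  replace (mag n k ^ 2 / (2 * (INR n + 1)) + - pt n k ^ 2 / 2 * shrink n) with 0.
  - rewrite exp_0. ring.
  - rewrite pt_mag. unfold shrink.
    replace ((mag n k / sqrt (INR n)) ^ 2) with (mag n k ^ 2 / INR n).
    + pose proof (lt_0_INR n Hn). field. lra.
    + rewrite <- (sqrt_sqrt (INR n)) at 1 by lra. field. lra.
Qed.

Lemma shrink_range (n : nat) : 0 <= shrink n <= 1.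
Proof.
  pose proof (pos_INR n). unfold shrink. split; [apply Rdiv_le_0_compat; lra|].
  apply Rmult_le_reg_r with (INR n + 1); [lra|]. unfold Rdiv.
  rewrite Rmult_assoc, Rinv_l; lra.
Qed.

Lemma bdens_upper (n : nat) (x : R) : (0 < n)%nat ->
  0 < bdens n x <= exp (- x ^ 2 / 2 * shrink n).
Proof.
  intros Hn. pose proof (shrink_range n).
  destruct (bdens_cases n x Hn) as [[k [Hk [-> ->]]]| ->].
  - pose proof (peak_pos n) as Hp. split.
    + apply Rdiv_lt_0_compat; [apply binom_pos|auto].
    + rewrite binom_nbin by auto. pose proof (nbin_le_peak n k Hk).
      apply Rmult_le_reg_r with (peak n); auto. unfold Rdiv.
      rewrite (Rmult_assoc _ (/ peak n)), Rinv_l by lra.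
      pose proof (exp_pos (- pt n k ^ 2 * / 2 * shrink n)). nra.
  - split; [apply exp_pos|]. apply exp_le_mono. pose proof (pow2_ge_0 x). nra.
Qed.

(** On the lattice [Rabs (mag n k) <= M * sqrt n], so the loss in [peak_le_nbin] is at most
    [2 * M ^ 3 / sqrt n], that is [M ^ 3 * mesh n]. The condition [4 * M ^ 2 <= n] keeps the point
    in the range of that lemma. *)
Lemma bdens_lower (n : nat) (x M : R) : (0 < n)%nat -> 0 <= M -> Rabs x <= M ->
  4 * M ^ 2 <= INR n -> 
  exp (- x ^ 2 / 2 - M ^ 3 * mesh n) <= bdens n x.
Proof.
  intros Hn HM Hx HnM. pose proof (sqrt_INR_pos n Hn) as Hs.
  pose proof (mesh_pos n Hn) as Hm. pose proof (shrink_range n) as Hsh.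
  assert (HM3 : 0 <= M ^ 3 * mesh n) by (apply Rmult_le_pos; [apply pow_le; auto|lra]).
  destruct (bdens_cases n x Hn) as [[k [Hk [E ->]]]| ->].
  2: apply exp_le_mono; lra.
  pose proof (peak_pos n) as Hp. pose proof (pos_INR n) as Hn0.
  assert (Hss : sqrt (INR n) ^ 2 = INR n) by (rewrite pow2_sqrt; lra).
  assert (Emag : mag n k = x * sqrt (INR n)) by (rewrite E, pt_mag; field; lra).
  assert (Hamag : Rabs (mag n k) <= M * sqrt (INR n)).
  { rewrite Emag, Rabs_mult, (Rabs_pos_eq (sqrt _)) by lra. apply Rmult_le_compat_r; lra. }
  assert (H2M : 2 * M <= sqrt (INR n)).
  { apply Rsqr_incr_0_var; [|lra]. rewrite !Rsqr_pow2, Hss. lra. }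
  pose proof (Rabs_pos (mag n k)) as Hap.
  assert (Hsmall : Rabs (mag n k) / (INR n + 1) <= 1 / 2).
  { apply Rmult_le_reg_r with (INR n + 1); [lra|]. unfold Rdiv at 1.
    rewrite Rmult_assoc, Rinv_l by lra. nra. }
  pose proof (peak_le_nbin n k Hk Hsmall) as HP.
  assert (Herr : 2 * Rabs (mag n k) ^ 3 / (INR n + 1) ^ 2 <= M ^ 3 * mesh n).
  { apply Rmult_le_reg_r with ((INR n + 1) ^ 2); [apply pow_lt; lra|].
    unfold Rdiv. rewrite Rmult_assoc, Rinv_l, Rmult_1_r by (apply pow_nonzero; lra).
    apply Rle_trans with (2 * (M * sqrt (INR n)) ^ 3).
    - apply Rmult_le_compat_l; [lra|]. apply pow_incr; lra.
    - replace (2 * (M * sqrt (INR n)) ^ 3) with (M ^ 3 * mesh n * INR n ^ 2).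
      + apply Rmult_le_compat_l; auto. apply pow_incr; lra.
      + replace (INR n ^ 2) with ((sqrt (INR n) ^ 2) ^ 2) by (rewrite Hss; reflexivity).
        unfold mesh. field. lra. }
  rewrite binom_nbin by auto. rewrite <- E.
  apply Rmult_le_reg_r with (peak n); auto. unfold Rdiv at 2.
  rewrite (Rmult_assoc _ (/ peak n)), Rinv_l, Rmult_1_r by lra.
  eapply Rle_trans.
  { apply Rmult_le_compat_l; [apply Rlt_le, exp_pos|exact HP]. }
  rewrite (Rmult_comm _ (nbin n k * _)), Rmult_assoc, <- exp_plus.
  apply Rmult_le_compat_l; [apply Rlt_le, nbin_pos|]. apply exp_le_mono.
  pose proof (pow2_ge_0 x). nra.
Qed.

Lemma shrink_lim : is_lim_seq shrink 1.
Proof.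
  apply is_lim_seq_ext with (fun n => 1 - / INR (S n)).
  - intros n. unfold shrink. rewrite S_INR. pose proof (pos_INR n). field. lra.
  - replace (Finite 1) with (Rbar_minus 1 (Rbar_inv p_infty)) by (simpl; f_equal; ring).
    apply is_lim_seq_minus'; [apply is_lim_seq_const|].
    apply (is_lim_seq_inv (fun n => INR (S n)) p_infty); [|discriminate].
    apply (is_lim_seq_incr_1 INR), is_lim_seq_INR.
Qed.

Lemma mesh_lim : is_lim_seq mesh 0.
Proof.
  apply is_lim_seq_spec. intros [eps He]. destruct (mesh_small eps He) as [n0 H].
  exists n0. intros n Hn. destruct (H n Hn) as [Hp Hm]. pose proof (mesh_pos n Hp).
  simpl. rewrite Rminus_0_r, Rabs_pos_eq; lra.
Qed.

Lemma bdens_lim (y : R) :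
  filterlim (fun p : nat * R => bdens (fst p) (snd p))
    (filter_prod eventually (locally y)) (locally (exp (- y ^ 2 / 2))).
Proof.
  set (M := Rabs y + 1). assert (HM : 0 <= M) by (pose proof (Rabs_pos y); unfold M; lra).
  assert (Hx2 : filterlim (fun p : nat * R => - snd p ^ 2 / 2)
            (filter_prod eventually (locally y)) (locally (- y ^ 2 / 2))).
  { apply (filterlim_comp _ _ _ snd (fun x => - x ^ 2 / 2) _ (locally y)).
    apply filterlim_snd. apply (continuous_derivable (fun x => - x ^ 2 / 2)). auto_derive; auto. }
  assert (Hfst : filterlim (fst (A := nat) (B := R)) (filter_prod eventually (locally y)) eventually)
    by apply filterlim_fst.
  assert (Hexp : forall z, filterlim exp (locally z) (locally (exp z))).
  { intros z. apply (continuous_derivable exp). auto_derive; auto. }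
  apply (filterlim_le_le
    (fun p => exp (- snd p ^ 2 / 2 - M ^ 3 * mesh (fst p)))
    (fun p : nat * R => bdens (fst p) (snd p))
    (fun p => exp (- snd p ^ 2 / 2 * shrink (fst p))) (exp (- y ^ 2 / 2))).
  - destruct (archimed (4 * M ^ 2)) as [Ha _].
    apply Filter_prod with (fun n => (0 < n)%nat /\ 4 * M ^ 2 <= INR n)
      (fun x => Rabs (x - y) < 1).
    + exists (S (Z.to_nat (up (4 * M ^ 2)))). intros n Hn. split; [lia|].
      assert (Hu : Z.le 0 (up (4 * M ^ 2))) by (apply le_IZR; pose proof (pow2_ge_0 M); lra).
      assert (Hn' : (Z.to_nat (up (4 * M ^ 2)) <= n)%nat) by lia.
      apply le_INR in Hn'. rewrite INR_IZR_INZ, Z2Nat.id in Hn' by auto. lra.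
    + exists (mkposreal 1 Rlt_0_1). intros x Hx. exact Hx.
    + intros n x [Hn HnM] Hx. simpl. split.
      * apply bdens_lower; auto. unfold M.
        replace x with ((x - y) + y) by ring. eapply Rle_trans; [apply Rabs_triang|]. lra.
      * apply bdens_upper, Hn.
  - apply (filterlim_comp _ _ _ (fun p : nat * R => - snd p ^ 2 / 2 - M ^ 3 * mesh (fst p)) exp
      _ (locally (- y ^ 2 / 2))); [|apply Hexp].
    replace (- y ^ 2 / 2) with (minus (- y ^ 2 / 2) (scal (M ^ 3) 0)) at 1
      by (unfold minus, plus, opp, scal; simpl; unfold mult; simpl; ring).
    apply (filterlim_comp_2 (fun p : nat * R => - snd p ^ 2 / 2)
      (fun p : nat * R => opp (scal (M ^ 3) (mesh (fst p)))) plus Hx2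
      (H := locally (opp (scal (M ^ 3) 0)))).
    + apply (filterlim_comp _ _ _ (fun p : nat * R => scal (M ^ 3) (mesh (fst p))) opp _
        (locally (scal (M ^ 3) 0))); [|apply (filterlim_opp (V := R_NormedModule))].
      apply (filterlim_comp _ _ _ (fun p : nat * R => mesh (fst p)) (scal (M ^ 3)) _ (locally 0));
        [|apply (filterlim_scal_r (V := R_NormedModule))].
      apply (filterlim_comp _ _ _ fst mesh _ eventually); [exact Hfst|apply mesh_lim].
    + apply (filterlim_plus (V := R_NormedModule)).
  - apply (filterlim_comp _ _ _ (fun p : nat * R => - snd p ^ 2 / 2 * shrink (fst p)) exp
      _ (locally (- y ^ 2 / 2))); [|apply Hexp].
    replace (- y ^ 2 / 2) with (mult (- y ^ 2 / 2) 1) at 1 by (unfold mult; simpl; ring).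
    apply (filterlim_comp_2 (fun p : nat * R => - snd p ^ 2 / 2)
      (fun p : nat * R => shrink (fst p)) mult Hx2 (H := locally 1)).
    + apply (filterlim_comp _ _ _ fst shrink _ eventually); [exact Hfst|apply shrink_lim].
    + apply (filterlim_mult (K := R_AbsRing)).
Qed.

(** * The model as a lattice sum *)

Lemma sum_pascal (G : nat -> R) (n : nat) :
  sum_f_R0 (fun k => Binomial.C n k * G k) n + sum_f_R0 (fun k => Binomial.C n k * G (S k)) n =
  sum_f_R0 (fun k => Binomial.C (S n) k * G k) (S n).
Proof.
  destruct n as [|m].
  - simpl. rewrite !C_n_0, C_n_n. ring.
  (* The first and last terms are split off because Pascal's rule holds only at interior indices. *)
  - rewrite (decomp_sum (fun k => Binomial.C (S m) k * G k)) by lia.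
    rewrite (decomp_sum (fun k => Binomial.C (S (S m)) k * G k)) by lia.
    simpl Nat.pred.
    rewrite (tech5 (fun k => Binomial.C (S m) k * G (S k))).
    rewrite (tech5 (fun k => Binomial.C (S (S m)) (S k) * G (S k))).
    rewrite !C_n_0, !C_n_n.
    rewrite (sum_eq (fun k => Binomial.C (S (S m)) (S k) * G (S k))
      (fun k => Binomial.C (S m) (S k) * G (S k) + Binomial.C (S m) k * G (S k))).
    + rewrite sum_plus. ring.
    + intros i Hi. rewrite <- pascal by lia. ring.
Qed.

Lemma sumR_app (l1 l2 : list R) : sumR (l1 ++ l2) = sumR l1 + sumR l2.
Proof.
  induction l1 as [|x l1 IH]; simpl; [|unfold sumR in *; simpl; rewrite IH]; unfold sumR; simpl; ring.
Qed.

(** Splitting on the first spin shifts the argument of [g]: a spin 1 keeps the number [k] of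
    negative spins and a spin -1 raises it, which is Pascal's recursion. Hence the induction is over
    all [g]. *)
Lemma sum_configs_binom (n : nat) (g : R -> R) :
  sumR (map (fun x => g (sumR x)) (configs n)) =
  sum_f_R0 (fun k => Binomial.C n k * g (mag n k)) n.
Proof.
  revert g. induction n as [|n IH]; intros g.
  - simpl. unfold sumR, mag; simpl. rewrite C_n_0.
    replace (0 - 2 * 0) with 0 by ring. ring.
  - change (configs (S n)) with (map (cons 1) (configs n) ++ map (cons (-1)) (configs n)).
    rewrite map_app, sumR_app, !map_map.
    change (sumR (map (fun x => g (1 + sumR x)) (configs n)) +
      sumR (map (fun x => g (-1 + sumR x)) (configs n)) =
      sum_f_R0 (fun k => Binomial.C (S n) k * g (mag (S n) k)) (S n)).
    rewrite (IH (fun s => g (1 + s))), (IH (fun s => g (-1 + s))).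
    rewrite <- (sum_pascal (fun k => g (mag (S n) k))).
    f_equal; apply sum_eq; intros k _; f_equal; f_equal; unfold mag; rewrite !S_INR; ring.
Qed.

Lemma sum_configs_binom2 (n m : nat) (g : R -> R -> R) :
  sum_configs n m (fun x y => g (sumR x) (sumR y)) =
  sum_f_R0 (fun k => Binomial.C n k *
    sum_f_R0 (fun l => Binomial.C m l * g (mag n k) (mag m l)) m) n.
Proof.
  unfold sum_configs.
  replace (fun x => sumR (map (fun y => g (sumR x) (sumR y)) (configs m))) with
    (fun x => sum_f_R0 (fun l => Binomial.C m l * g (sumR x) (mag m l)) m).
  - apply (sum_configs_binom n (fun s => sum_f_R0 (fun l => Binomial.C m l * g s (mag m l)) m)).
  - apply functional_extensionality. intros x. symmetry.
    apply (sum_configs_binom m (g (sumR x))).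
Qed.

Definition ratio (N n : nat) : R := INR n / INR N.

(** At lattice points this is the number of configurations times the Gibbs weight, divided by
    [peak n * peak m]. With [s = x * sqrt n], the term [J1 * s ^ 2 / (2 * N)] becomes
    [ratio N n * J1 * x ^ 2 / 2]. *)
Definition cw_dens (J1 J2 Jb : R) (N n m : nat) (x y : R) : R :=
  bdens n x * bdens m y *
  exp ((ratio N n * J1 * x ^ 2 + ratio N m * J2 * y ^ 2
        + 2 * (sqrt (ratio N n * ratio N m) * Jb) * x * y) / 2).

Definition cw_lsum (J1 J2 Jb : R) (N n m : nat) (o1 o2 : option R) : R :=
  lsum n o1 (fun x => lsum m o2 (cw_dens J1 J2 Jb N n m x)).

Lemma cw_weight_pt (J1 J2 Jb s t : R) (N n m : nat) :
  (0 < N)%nat -> (0 < n)%nat -> (0 < m)%nat ->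
  exp (/ (2 * INR N) * (J1 * s ^ 2 + J2 * t ^ 2 + 2 * Jb * s * t)) =
  exp ((ratio N n * J1 * (s / sqrt (INR n)) ^ 2 + ratio N m * J2 * (t / sqrt (INR m)) ^ 2
        + 2 * (sqrt (ratio N n * ratio N m) * Jb) * (s / sqrt (INR n)) * (t / sqrt (INR m))) / 2).
Proof.
  intros HN Hn Hm. f_equal.
  pose proof (lt_0_INR N HN). pose proof (lt_0_INR n Hn). pose proof (lt_0_INR m Hm).
  pose proof (sqrt_INR_pos n Hn). pose proof (sqrt_INR_pos m Hm).
  assert (E : sqrt (ratio N n * ratio N m) = sqrt (INR n) * sqrt (INR m) / INR N).
  { unfold ratio. replace (INR n / INR N * (INR m / INR N)) with
      (INR n * INR m / (INR N) ^ 2) by (field; lra).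
    rewrite sqrt_div_alt by (apply pow_lt; lra).
    rewrite sqrt_pow2, sqrt_mult by lra. reflexivity. }
  rewrite E. unfold ratio.
  replace ((s / sqrt (INR n)) ^ 2) with (s ^ 2 / INR n).
  2:{ rewrite <- (sqrt_sqrt (INR n)) at 1 by lra. field. lra. }
  replace ((t / sqrt (INR m)) ^ 2) with (t ^ 2 / INR m).
  2:{ rewrite <- (sqrt_sqrt (INR m)) at 1 by lra. field. lra. }
  field. lra.
Qed.

Lemma sum_configs_lsum (J1 J2 Jb : R) (N n m : nat) (o1 o2 : option R) :
  (0 < N)%nat -> (0 < n)%nat -> (0 < m)%nat ->
  sum_configs n m (fun x y => cw_weight N J1 J2 Jb x y *
    (cut o1 (sumR x / sqrt (INR n)) * cut o2 (sumR y / sqrt (INR m)))) =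
  peak n * peak m / (mesh n * mesh m) * cw_lsum J1 J2 Jb N n m o1 o2.
Proof.
  intros HN Hn Hm.
  pose proof (peak_pos n). pose proof (peak_pos m).
  pose proof (mesh_pos n Hn). pose proof (mesh_pos m Hm).
  unfold cw_weight.
  rewrite (sum_configs_binom2 n m (fun s t =>
    exp (/ (2 * INR N) * (J1 * s ^ 2 + J2 * t ^ 2 + 2 * Jb * s * t)) *
    (cut o1 (s / sqrt (INR n)) * cut o2 (t / sqrt (INR m))))).
  unfold cw_lsum, lsum.
  rewrite <- Rmult_assoc, scal_sum. apply sum_eq. intros k Hk.
  replace (mesh m * sum_f_R0 _ m * cut o1 (pt n k) *
      (peak n * peak m / (mesh n * mesh m) * mesh n)) with
    (peak n * peak m * cut o1 (pt n k) *
     sum_f_R0 (fun l => cw_dens J1 J2 Jb N n m (pt n k) (pt m l) * cut o2 (pt m l)) m)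
    by (field; lra).
  rewrite !scal_sum. apply sum_eq. intros l Hl.
  unfold cw_dens. rewrite !bdens_pt by auto.
  rewrite (cw_weight_pt J1 J2 Jb (mag n k) (mag m l) N n m) by auto.
  rewrite <- !pt_mag. field. lra.
Qed.

Lemma cw_cdf_lsum (J1 J2 Jb a b : R) (N n m : nat) :
  (0 < N)%nat -> (0 < n)%nat -> (0 < m)%nat ->
  cw_cdf N n m J1 J2 Jb a b =
  cw_lsum J1 J2 Jb N n m (Some a) (Some b) / cw_lsum J1 J2 Jb N n m None None.
Proof.
  intros HN Hn Hm.
  pose proof (peak_pos n). pose proof (peak_pos m).
  pose proof (mesh_pos n Hn). pose proof (mesh_pos m Hm).
  assert (EZ : cw_Z N n m J1 J2 Jb =
    peak n * peak m / (mesh n * mesh m) * cw_lsum J1 J2 Jb N n m None None).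
  { rewrite <- sum_configs_lsum by auto. unfold cw_Z. f_equal.
    apply functional_extensionality; intros x. apply functional_extensionality; intros y.
    simpl. ring. }
  unfold cw_cdf. rewrite EZ.
  replace (sum_configs _ _ _) with
    (peak n * peak m / (mesh n * mesh m) * cw_lsum J1 J2 Jb N n m (Some a) (Some b)).
  - assert (HP : 0 < peak n * peak m / (mesh n * mesh m)).
    { apply Rdiv_lt_0_compat; apply Rmult_lt_0_compat; auto. }
    apply Rdiv_mult_l_l. lra.
  - rewrite <- sum_configs_lsum by auto. f_equal.
    apply functional_extensionality; intros x. apply functional_extensionality; intros y.
    f_equal. simpl. destruct (Rle_dec _ a); [destruct (Rle_dec _ b)|]; ring.
Qed.

(** * Bivariate Gaussian integrals *)

Lemma filterlim_Rplus {T : Type} (F : (T -> Prop) -> Prop) {FF : Filter F} (f g : T -> R) (a b : R) :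
  filterlim f F (locally a) -> filterlim g F (locally b) ->
  filterlim (fun t => f t + g t) F (locally (a + b)).
Proof.
  intros Hf Hg. apply (filterlim_comp_2 f g Rplus Hf Hg).
  apply (filterlim_plus (V := R_NormedModule)).
Qed.

Lemma filterlim_Rmult {T : Type} (F : (T -> Prop) -> Prop) {FF : Filter F} (f g : T -> R) (a b : R) :
  filterlim f F (locally a) -> filterlim g F (locally b) ->
  filterlim (fun t => f t * g t) F (locally (a * b)).
Proof.
  intros Hf Hg. apply (filterlim_comp_2 f g Rmult Hf Hg).
  apply (filterlim_mult (K := R_AbsRing)).
Qed.

Lemma filterlim_continuous {T : Type} (F : (T -> Prop) -> Prop) (f : T -> R) (h : R -> R) (a : R) :
  continuous h a -> filterlim f F (locally a) -> filterlim (fun t => h (f t)) F (locally (h a)).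
Proof. intros Hh Hf. exact (filterlim_comp _ _ _ f h F (locally a) (locally (h a)) Hf Hh). Qed.

Lemma filterlim_exp_quadratic {T : Type} (F : (T -> Prop) -> Prop) {FF : Filter F}
    (p q r u v : T -> R) (p0 q0 r0 x y : R) :
  filterlim p F (locally p0) -> filterlim q F (locally q0) -> filterlim r F (locally r0) ->
  filterlim u F (locally x) -> filterlim v F (locally y) ->
  filterlim (fun t => exp ((p t * u t ^ 2 + q t * v t ^ 2 + 2 * r t * u t * v t) / 2)) F
    (locally (exp ((p0 * x ^ 2 + q0 * y ^ 2 + 2 * r0 * x * y) / 2))).
Proof.
  intros Hp Hq Hr Hu Hv.
  apply (filterlim_continuous F _ (fun z => exp (z / 2))).
  { apply continuous_derivable. auto_derive; auto. }
  assert (Hsq : forall z, continuous (fun w => w ^ 2) z).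
  { intros z. apply continuous_derivable. auto_derive; auto. }
  repeat apply (filterlim_Rplus F).
  - apply (filterlim_Rmult F); auto. apply (filterlim_continuous F u (fun w => w ^ 2)); auto.
  - apply (filterlim_Rmult F); auto. apply (filterlim_continuous F v (fun w => w ^ 2)); auto.
  - apply (filterlim_Rmult F); auto. apply (filterlim_Rmult F); auto. apply (filterlim_Rmult F); auto.
    apply filterlim_const.
Qed.

(** The form is at least [l * (x ^ 2 + y ^ 2)]. Moving the coefficients by less than [e = l / 4]
    costs [l / 4] on the diagonal and [l / 4] in the cross term, leaving [l / 2 = 2 * e]. The
    allowance for perturbation serves the coefficients at finite [N]. *)
Lemma quad_coercive (A B c : R) : 0 < A -> 0 < B -> c ^ 2 < A * B ->
  exists e, 0 < e /\ forall A' B' c', Rabs (A' - A) < e -> Rabs (B' - B) < e ->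
    Rabs (c' - c) < e -> forall x y,
    2 * e * (x ^ 2 + y ^ 2) <= A' * x ^ 2 + B' * y ^ 2 - 2 * c' * x * y.
Proof.
  intros HA HB Hc.
  (* det / trace bounds the smallest eigenvalue from below *)
  set (l := (A * B - c ^ 2) / (A + B)).
  assert (Hl : 0 < l) by (apply Rdiv_lt_0_compat; lra).
  assert (El : l * (A + B) = A * B - c ^ 2) by (unfold l; field; lra).
  assert (HlA : l < A) by (apply Rmult_lt_reg_r with (A + B); [lra|]; rewrite El; nra).
  exists (l / 4). split; [lra|]. intros A' B' c' H1 H2 H3 x y.
  assert (Q : l * (x ^ 2 + y ^ 2) <= A * x ^ 2 + B * y ^ 2 - 2 * c * x * y).
  (* Completing the square: by the choice of [l] the shifted form has determinant exactly
     [l ^ 2]. *)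
  { assert (0 <= (A - l) * ((A - l) * x ^ 2 - 2 * c * x * y + (B - l) * y ^ 2)).
    { replace ((A - l) * ((A - l) * x ^ 2 - 2 * c * x * y + (B - l) * y ^ 2)) with
        (((A - l) * x - c * y) ^ 2 + (A * B - l * (A + B) + l ^ 2 - c ^ 2) * y ^ 2) by ring.
      rewrite El. replace (A * B - (A * B - c ^ 2) + l ^ 2 - c ^ 2) with (l ^ 2) by ring.
      rewrite <- Rpow_mult_distr. apply Rplus_le_le_0_compat; apply pow2_ge_0. }
    assert (0 <= (A - l) * x ^ 2 - 2 * c * x * y + (B - l) * y ^ 2).
    { apply Rmult_le_reg_l with (A - l); [lra|]. lra. }
    lra. }
  apply Rabs_lt_between in H1. apply Rabs_lt_between in H2. apply Rabs_lt_between in H3.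
  pose proof (pow2_ge_0 x). pose proof (pow2_ge_0 y).
  assert (Hxy : (c' - c) * (2 * x * y) <= l / 4 * (x ^ 2 + y ^ 2)).
  { pose proof (pow2_ge_0 (x + y)). pose proof (pow2_ge_0 (x - y)).
    assert (- (x ^ 2 + y ^ 2) <= 2 * x * y <= x ^ 2 + y ^ 2) by lra. nra. }
  nra.
Qed.

(** With [k = min 1 (e / 2)], [k * (1 + x ^ 2) <= 1 + e / 2 * x ^ 2 <= exp (e / 2 * x ^ 2)];
    squaring and inverting gives [K = / k ^ 2]. *)
Lemma gauss_tail (e : R) : 0 < e ->
  exists K, 0 < K /\ forall x, exp (- e * x ^ 2) <= tail_fun K x.
Proof.
  intros He. set (k := Rmin 1 (e / 2)).
  assert (Hk : 0 < k) by (apply Rmin_glb_lt; lra).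
  assert (Hk1 : k <= 1) by apply Rmin_l. assert (Hk2 : k <= e / 2) by apply Rmin_r.
  exists (/ k ^ 2). split; [apply Rinv_0_lt_compat, pow_lt, Hk|]. intros x.
  pose proof (pow2_ge_0 x) as Hx.
  unfold tail_fun, Rdiv. rewrite <- Rinv_mult, <- Rpow_mult_distr.
  replace (- e * x ^ 2) with (- (e / 2 * x ^ 2 + e / 2 * x ^ 2)) by field.
  rewrite exp_Ropp, exp_plus. assert (Hp : 0 < k * (1 + x ^ 2)) by (apply Rmult_lt_0_compat; lra).
  apply Rinv_le_contravar; [apply pow_lt, Hp|].
  pose proof (exp_ineq1_le (e / 2 * x ^ 2)).
  pose proof (Rmult_le_compat_r (x ^ 2) _ _ Hx Hk2).
  assert (k * (1 + x ^ 2) <= exp (e / 2 * x ^ 2)) by lra.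
  apply Rle_trans with (k * (1 + x ^ 2) * (k * (1 + x ^ 2))); [right; ring|].
  apply Rmult_le_compat; lra.
Qed.

(** Lets the one-variable bounds act on a product: summing over [y] leaves a multiple of the
    coefficient, again a [tail_fun] in [x]. *)
Lemma tail_fun_mult (K L x y : R) : tail_fun K x * tail_fun L y = tail_fun (tail_fun K x * L) y.
Proof. unfold tail_fun, Rdiv. ring. Qed.

Lemma tail_fun_coef_le (K x y : R) : 0 <= K ->
  tail_fun (tail_fun K x * K) y <= tail_fun (K * K) y.
Proof.
  intros HK. unfold tail_fun at 1 3. apply Rmult_le_compat_r.
  - apply Rlt_le, Rinv_0_lt_compat, pow_lt. pose proof (one_plus_sqr_ge1 y); lra.
  - apply Rmult_le_compat_r; [lra|]. apply tail_fun_le_const, HK.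
Qed.

(** The primitive is [erf0] in the variable [sqrt b * (y - mu)]. The factor [k] and the centre [mu]
    are free because both depend on the outer variable when the square is completed in
    [gauss2_mass]. *)
Lemma impint_gauss (k b mu : R) : 0 < b ->
  impint None (fun y => k * exp (- b * (y - mu) ^ 2 / 2)) = k * sqrt (2 * PI / b).
Proof.
  intros Hb. pose proof PI_RGT_0 as Hpi.
  assert (Hs : 0 < sqrt b) by (apply sqrt_lt_R0, Hb).
  assert (Hss : sqrt b * sqrt b = b) by (apply sqrt_sqrt; lra).
  assert (E : forall M, RInt (fun y => k * exp (- b * (y - mu) ^ 2 / 2)) (- M) M =
    k / sqrt b * (erf0 (sqrt b * M + - (sqrt b * mu)) + erf0 (sqrt b * M + sqrt b * mu))).
  { intros M. apply is_RInt_unique.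
    replace (k / sqrt b * (erf0 (sqrt b * M + - (sqrt b * mu)) + erf0 (sqrt b * M + sqrt b * mu)))
      with (minus (k / sqrt b * erf0 (sqrt b * (M - mu))) (k / sqrt b * erf0 (sqrt b * (- M - mu)))).
    - apply (is_RInt_derive (V := R_CompleteNormedModule)
        (fun y => k / sqrt b * erf0 (sqrt b * (y - mu)))).
      + intros y _. evar_last.
        * apply is_derive_scal. apply (is_derive_comp erf0 (fun z => sqrt b * (z - mu))).
          apply erf0_derive. auto_derive; [exact I|reflexivity].
        * unfold scal; simpl; unfold mult; simpl.
          replace (- (sqrt b * (y - mu) * (sqrt b * (y - mu) * 1)) / 2) with
            (- (sqrt b * sqrt b) * ((y - mu) * ((y - mu) * 1)) / 2) by (unfold Rdiv; ring).
          rewrite Hss. field. lra.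
      + intros y _. apply continuous_derivable. auto_derive; auto.
    - replace (sqrt b * (- M - mu)) with (- (sqrt b * M + sqrt b * mu)) by ring.
      replace (sqrt b * (M - mu)) with (sqrt b * M + - (sqrt b * mu)) by ring.
      rewrite erf0_odd. unfold minus, plus, opp; simpl. ring. }
  assert (L : forall d, is_lim (fun M => erf0 (sqrt b * M + d)) p_infty (sqrt (PI / 2))).
  { intros d. apply (is_lim_comp erf0 (fun M => sqrt b * M + d) p_infty (sqrt (PI / 2)) p_infty).
    - apply erf0_lim.
    - apply is_lim_spec. intros X. exists ((X - d) / sqrt b). intros M HM.
      apply Rmult_lt_compat_l with (r := sqrt b) in HM; auto.
      replace (sqrt b * ((X - d) / sqrt b)) with (X - d) in HM by (field; lra). lra.
    - exists 0. intros; discriminate. }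
  unfold impint. simpl upper.
  rewrite (is_lim_unique _ p_infty (k / sqrt b * (sqrt (PI / 2) + sqrt (PI / 2)))).
  - cbn [real]. replace (2 * PI / b) with (PI / 2 * 2 ^ 2 / b) by (field; lra).
    rewrite (sqrt_div_alt (PI / 2 * 2 ^ 2)) by auto.
    rewrite (sqrt_mult (PI / 2)), sqrt_pow2 by lra. field. lra.
  - apply is_lim_ext with (fun M => k / sqrt b *
      (erf0 (sqrt b * M + - (sqrt b * mu)) + erf0 (sqrt b * M + sqrt b * mu))).
    + intros M. symmetry. apply E.
    + apply (is_lim_scal_l _ (k / sqrt b) p_infty (sqrt (PI / 2) + sqrt (PI / 2))).
      apply is_lim_plus'; apply L.
Qed.

(** The unnormalised Gaussian with precision matrix [[[A, - c], [- c, B]]]. *)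
Definition gauss2 (A B c x y : R) : R := exp ((- A * x ^ 2 + - B * y ^ 2 + 2 * c * x * y) / 2).

Lemma gauss2_mass (A B c : R) : 0 < A -> 0 < B -> c ^ 2 < A * B ->
  impint None (fun x => impint None (gauss2 A B c x)) = 2 * PI / sqrt (A * B - c ^ 2).
Proof.
  intros HA HB Hc. pose proof PI_RGT_0 as Hpi.
  set (D := A * B - c ^ 2). assert (HD : 0 < D) by (unfold D; lra).
  replace (fun x => impint None (gauss2 A B c x)) with
    (fun x => sqrt (2 * PI / B) * exp (- (D / B) * (x - 0) ^ 2 / 2)).
  - rewrite impint_gauss by (apply Rdiv_lt_0_compat; lra).
    rewrite <- sqrt_mult_alt by (apply Rlt_le, Rdiv_lt_0_compat; lra).
    replace (2 * PI / B * (2 * PI / (D / B))) with ((2 * PI) ^ 2 / D) by (field; lra).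
    rewrite sqrt_div_alt by auto. rewrite sqrt_pow2 by lra. reflexivity.
  - apply functional_extensionality. intros x.
    rewrite Rmult_comm, <- (impint_gauss _ B (c * x / B)) by auto. f_equal.
    apply functional_extensionality. intros y. unfold gauss2. rewrite <- exp_plus.
    f_equal. unfold D. field. lra.
Qed.

Lemma gauss2_continuous (A B c x y : R) :
  filterlim (fun p : R * R => gauss2 A B c (fst p) (snd p))
    (filter_prod (locally x) (locally y)) (locally (gauss2 A B c x y)).
Proof.
  apply (filterlim_exp_quadratic (filter_prod (locally x) (locally y))
    (fun _ => - A) (fun _ => - B) (fun _ => c) fst snd); try apply filterlim_const.
  apply filterlim_fst. apply filterlim_snd.
Qed.

(** The parameter is treated as the index, with filter [locally x], so [limit_along_uniform] gives
    uniform closeness on [[u, v]]. *)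
Lemma RInt_param_continuous (f : R -> R -> R) (u v x : R) : u <= v ->
  (forall x y, continuous (f x) y) ->
  (forall y, filterlim (fun p : R * R => f (fst p) (snd p))
    (filter_prod (locally x) (locally y)) (locally (f x y))) ->
  continuous (fun z => RInt (f z) u v) x.
Proof.
  intros Huv Hc Hf. apply filterlim_locally. intros [eps He].
  set (e := eps / (v - u + 1)).
  assert (Hepos : 0 < e) by (apply Rdiv_lt_0_compat; lra).
  destruct (limit_along_uniform (locally x) f (f x) u v e Hf (Hc x) Hepos) as [d [Hd H]].
  revert H. apply filter_imp. intros z Hz.
  change (Rabs (RInt (f z) u v - RInt (f x) u v) < eps).
  replace (RInt (f z) u v - RInt (f x) u v) with (RInt (fun y => f z y - f x y) u v).
  - apply Rle_lt_trans with ((v - u) * e).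
    + apply abs_RInt_le_const; auto.
      * apply ex_RInt_everywhere. intros y.
        apply (continuous_minus (V := R_NormedModule) (f z) (f x)); apply Hc.
      * intros y Hy. apply Rlt_le, Hz; auto. rewrite Rminus_diag, Rabs_R0. exact Hd.
    + apply Rlt_le_trans with ((v - u + 1) * e); [nra|]. right. unfold e. field. lra.
  - apply (RInt_minus (V := R_CompleteNormedModule) (f z) (f x));
      apply ex_RInt_everywhere, Hc.
Qed.

Lemma Rint_RInt (f : R -> R) (a b : R) : ex_RInt f a b -> Rint f a b = RInt f a b.
Proof.
  intros H. unfold Rint. destruct (excluded_middle_informative _) as [E|E].
  - symmetry. apply RInt_Reals.
  - exfalso. apply E. exists (ex_RInt_Reals_0 f a b H). exact I.
Qed.

Lemma RInt_scal_R (f : R -> R) (k a b : R) : (forall x, continuous f x) ->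
  RInt (fun x => k * f x) a b = k * RInt f a b.
Proof.
  intros Hf. apply (RInt_scal (V := R_CompleteNormedModule) f a b k).
  apply ex_RInt_everywhere, Hf.
Qed.

(* Both box ends move together with [M], whereas [impint] is iterated: the inner
   tail is [O(1 / M^2)] uniformly in [x] and the outer range has length [O(M)]. *)
Lemma box_integral_cv (f : R -> R -> R) (K L a b : R) :
  (forall x y, continuous (f x) y) ->
  (forall x y, filterlim (fun p : R * R => f (fst p) (snd p))
    (filter_prod (locally x) (locally y)) (locally (f x y))) ->
  (forall x y, Rabs (f x y) <= tail_fun K y) ->
  (forall x, continuous (fun z => impint (Some b) (f z)) x) ->
  (forall x, Rabs (impint (Some b) (f x)) <= tail_fun L x) ->
  forall eps, 0 < eps -> exists M0, forall M, M0 <= M ->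
    (forall x, continuous (fun z => RInt (f z) (- M) b) x) /\
    Rabs (RInt (fun x => RInt (f x) (- M) b) (- M) a -
          impint (Some a) (fun x => impint (Some b) (f x))) < eps.
Proof.
  intros Hc Hf HK HG HL eps He. pose proof PI_RGT_0 as Hpi.
  pose proof (tail_fun_dominates_ge0 _ K (HK 0)) as HK0.
  pose proof (tail_fun_dominates_ge0 _ L HL) as HL0.
  (* Since [a + M <= 2 * M] and [1 <= M], the two errors together are at most [X * M / (1 + M ^ 2)],
     which is below [eps] once [M > X / eps]. *)
  set (X := 2 * (K * (2 * PI)) + L * (2 * PI)).
  assert (HX : 0 <= X) by (unfold X; nra).
  assert (HXe : 0 <= X / eps) by (apply Rdiv_le_0_compat; lra).
  exists (Rabs a + Rabs b + X / eps + 1). intros M HM.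
  pose proof (Rabs_pos a). pose proof (Rabs_pos b).
  assert (HM1 : 1 <= M) by lra.
  assert (Ha : - M <= a <= M) by (apply Rabs_le_between; lra).
  assert (Hb : - M <= b <= M) by (apply Rabs_le_between; lra).
  assert (HgM : forall x, continuous (fun z => RInt (f z) (- M) b) x).
  { intros x. apply RInt_param_continuous; auto. lra. }
  split; [exact HgM|].
  set (G := fun x => impint (Some b) (f x)) in *.
  assert (E1 : Rabs (RInt (fun x => RInt (f x) (- M) b) (- M) a - RInt G (- M) a)
     <= (a - - M) * (K / (1 + M ^ 2) * (2 * PI))).
  { replace (RInt (fun x => RInt (f x) (- M) b) (- M) a - RInt G (- M) a) with
      (RInt (fun x => RInt (f x) (- M) b - G x) (- M) a).
    - apply abs_RInt_le_const; [lra| |].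
      + apply ex_RInt_everywhere. intros x.
        apply (continuous_minus (V := R_NormedModule) (fun x => RInt (f x) (- M) b) G); auto.
      + intros x _. apply (impint_tail (f x) (Some b) K M); auto. split; lra.
    - apply (RInt_minus (V := R_CompleteNormedModule) (fun x => RInt (f x) (- M) b) G);
        apply ex_RInt_everywhere; auto. }
  pose proof (impint_tail G (Some a) L M HG HL) as E2. simpl upper in E2.
  specialize (E2 ltac:(split; lra)).
  replace (RInt (fun x => RInt (f x) (- M) b) (- M) a - impint (Some a) G) with
    ((RInt (fun x => RInt (f x) (- M) b) (- M) a - RInt G (- M) a) +
     (RInt G (- M) a - impint (Some a) G)) by ring.
  eapply Rle_lt_trans; [apply Rabs_triang|].
  assert (HM2 : 0 < 1 + M ^ 2) by nra.
  assert (Hinv : 0 < / (1 + M ^ 2)) by (apply Rinv_0_lt_compat; lra).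
  apply Rle_lt_trans with (X * M * / (1 + M ^ 2)).
  - apply Rle_trans with ((2 * M) * (K / (1 + M ^ 2) * (2 * PI)) + M * (L / (1 + M ^ 2) * (2 * PI))).
    + apply Rplus_le_compat; (eapply Rle_trans; [eassumption|]).
      * apply Rmult_le_compat_r; [|lra]. unfold Rdiv.
        apply Rmult_le_pos; [apply Rmult_le_pos|]; lra.
      * rewrite <- (Rmult_1_l (L / _ * _)) at 1. apply Rmult_le_compat_r; [|lra]. unfold Rdiv.
        apply Rmult_le_pos; [apply Rmult_le_pos|]; lra.
    + right. unfold X, Rdiv. ring.
  - apply Rmult_lt_reg_r with (1 + M ^ 2); auto.
    rewrite Rmult_assoc, Rinv_l, Rmult_1_r by lra.
    assert (X < eps * M).
    { apply Rmult_lt_reg_r with (/ eps); [apply Rinv_0_lt_compat; auto|].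
      replace (eps * M * / eps) with M by (field; lra). unfold Rdiv in HM. lra. }
    nra.
Qed.

(** * The limit theorem *)

(** The product filter is nested to the left so that the pair [(N, x)] can serve as the index of the
    inner sum over [y]. *)
Lemma cw_dens_lim (N1 N2 : nat -> nat) (a1 a2 J1 J2 Jb x y : R) :
  filterlim N1 eventually eventually -> filterlim N2 eventually eventually ->
  is_lim_seq (fun N => ratio N (N1 N)) a1 -> is_lim_seq (fun N => ratio N (N2 N)) a2 ->
  0 < a1 * a2 ->
  filterlim (fun p : (nat * R) * R => cw_dens J1 J2 Jb (fst (fst p)) (N1 (fst (fst p)))
      (N2 (fst (fst p))) (snd (fst p)) (snd p))
    (filter_prod (filter_prod eventually (locally x)) (locally y))
    (locally (gauss2 (1 - a1 * J1) (1 - a2 * J2) (sqrt (a1 * a2) * Jb) x y)).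
Proof.
  intros H1 H2 Hr1 Hr2 Ha.
  set (F := filter_prod (filter_prod eventually (locally x)) (locally y)).
  assert (FF : Filter F) by (unfold F; apply filter_prod_filter; [apply filter_prod_filter|]; typeclasses eauto).
  assert (HN : filterlim (fun p : (nat * R) * R => fst (fst p)) F eventually).
  { apply (filterlim_comp _ _ _ fst fst F (filter_prod eventually (locally x)));
      apply filterlim_fst. }
  assert (Hx : filterlim (fun p : (nat * R) * R => snd (fst p)) F (locally x)).
  { apply (filterlim_comp _ _ _ fst snd F (filter_prod eventually (locally x)));
      [apply filterlim_fst|apply filterlim_snd]. }
  assert (Hy : filterlim (fun p : (nat * R) * R => snd p) F (locally y)) by apply filterlim_snd.
  assert (R1 : filterlim (fun p : (nat * R) * R => ratio (fst (fst p)) (N1 (fst (fst p)))) F (locally a1))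
    by exact (filterlim_comp _ _ _ _ (fun N => ratio N (N1 N)) _ _ _ HN Hr1).
  assert (R2 : filterlim (fun p : (nat * R) * R => ratio (fst (fst p)) (N2 (fst (fst p)))) F (locally a2))
    by exact (filterlim_comp _ _ _ _ (fun N => ratio N (N2 N)) _ _ _ HN Hr2).
  assert (M1 : filterlim (fun p : (nat * R) * R => N1 (fst (fst p))) F eventually)
    by exact (filterlim_comp _ _ _ _ N1 _ _ _ HN H1).
  assert (M2 : filterlim (fun p : (nat * R) * R => N2 (fst (fst p))) F eventually)
    by exact (filterlim_comp _ _ _ _ N2 _ _ _ HN H2).
  unfold cw_dens.
  replace (gauss2 (1 - a1 * J1) (1 - a2 * J2) (sqrt (a1 * a2) * Jb) x y) with
    (exp (- x ^ 2 / 2) * exp (- y ^ 2 / 2) *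
     exp ((a1 * J1 * x ^ 2 + a2 * J2 * y ^ 2 + 2 * (sqrt (a1 * a2) * Jb) * x * y) / 2)).
  2:{ rewrite <- !exp_plus. unfold gauss2. f_equal. field. }
  apply (filterlim_Rmult F); [apply (filterlim_Rmult F)|].
  - apply (filterlim_comp_2 _ _ bdens M1 Hx). apply bdens_lim.
  - apply (filterlim_comp_2 _ _ bdens M2 Hy). apply bdens_lim.
  - apply (filterlim_exp_quadratic F); auto.
    + apply (filterlim_Rmult F); [exact R1|apply filterlim_const].
    + apply (filterlim_Rmult F); [exact R2|apply filterlim_const].
    + apply (filterlim_Rmult F); [|apply filterlim_const].
      apply (filterlim_continuous F _ sqrt).
      * apply continuity_pt_filterlim, continuity_pt_sqrt. lra.
      * apply (filterlim_Rmult F); auto.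
Qed.

Lemma gauss2_dominated (e K A B c x y : R) :
  (forall z, exp (- e * z ^ 2) <= tail_fun K z) ->
  2 * e * (x ^ 2 + y ^ 2) <= A * x ^ 2 + B * y ^ 2 - 2 * c * x * y ->
  Rabs (gauss2 A B c x y) <= tail_fun (tail_fun K x * K) y.
Proof.
  intros HK HQ. unfold gauss2. rewrite Rabs_pos_eq by apply Rlt_le, exp_pos.
  rewrite <- tail_fun_mult.
  apply Rle_trans with (exp (- e * x ^ 2) * exp (- e * y ^ 2)).
  - rewrite <- exp_plus. apply exp_le_mono. lra.
  - apply Rmult_le_compat; auto; apply Rlt_le, exp_pos.
Qed.

(** Puts the finite-size weight under a Gaussian whose coefficients converge to the limiting ones,
    so that [quad_coercive] supplies one bound for all large [N]. *)
Lemma cw_dens_le_gauss2 (J1 J2 Jb : R) (N n m : nat) (x y : R) : (0 < n)%nat -> (0 < m)%nat ->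
  Rabs (cw_dens J1 J2 Jb N n m x y) <=
  Rabs (gauss2 (shrink n - ratio N n * J1) (shrink m - ratio N m * J2)
          (sqrt (ratio N n * ratio N m) * Jb) x y).
Proof.
  intros Hn Hm. destruct (bdens_upper n x Hn) as [P1 U1]. destruct (bdens_upper m y Hm) as [P2 U2].
  unfold cw_dens, gauss2.
  rewrite !Rabs_mult, (Rabs_pos_eq (bdens n x)), (Rabs_pos_eq (bdens m y)) by lra.
  rewrite !(Rabs_pos_eq (exp _)) by apply Rlt_le, exp_pos.
  eapply Rle_trans.
  - apply Rmult_le_compat_r; [apply Rlt_le, exp_pos|].
    apply Rmult_le_compat; [lra|lra|exact U1|exact U2].
  - rewrite <- !exp_plus. right. f_equal. field.
Qed.

Lemma is_lim_seq_close (u : nat -> R) (l e : R) : is_lim_seq u l -> 0 < e ->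
  eventually (fun N => Rabs (u N - l) < e).
Proof. intros H He. exact (proj2 (is_lim_seq_spec _ _) H (mkposreal e He)). Qed.

Lemma cw_dens_dominated (N1 N2 : nat -> nat) (a1 a2 J1 J2 Jb : R) :
  filterlim N1 eventually eventually -> filterlim N2 eventually eventually ->
  is_lim_seq (fun N => ratio N (N1 N)) a1 -> is_lim_seq (fun N => ratio N (N2 N)) a2 ->
  0 < a1 * a2 -> 0 < 1 - a1 * J1 -> 0 < 1 - a2 * J2 ->
  (sqrt (a1 * a2) * Jb) ^ 2 < (1 - a1 * J1) * (1 - a2 * J2) ->
  exists K, 0 < K /\
    (forall x y, Rabs (gauss2 (1 - a1 * J1) (1 - a2 * J2) (sqrt (a1 * a2) * Jb) x y)
                 <= tail_fun (tail_fun K x * K) y) /\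
    eventually (fun N => forall x y, Rabs (cw_dens J1 J2 Jb N (N1 N) (N2 N) x y)
                 <= tail_fun (tail_fun K x * K) y).
Proof.
  intros H1 H2 Hr1 Hr2 Ha HA HB Hc.
  destruct (quad_coercive _ _ _ HA HB Hc) as [e [He HQ]].
  destruct (gauss_tail e He) as [K [HK0 HK]].
  exists K. split; [exact HK0|]. split.
  - intros x y. apply (gauss2_dominated e); auto.
    apply HQ; rewrite Rminus_diag, Rabs_R0; exact He.
  - assert (L1 : is_lim_seq (fun N => shrink (N1 N) - ratio N (N1 N) * J1) (1 - a1 * J1)).
    { apply is_lim_seq_minus'.
      - apply (is_lim_seq_subseq shrink 1 N1 H1 shrink_lim).
      - apply is_lim_seq_mult'; [exact Hr1|apply is_lim_seq_const]. }
    assert (L2 : is_lim_seq (fun N => shrink (N2 N) - ratio N (N2 N) * J2) (1 - a2 * J2)).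
    { apply is_lim_seq_minus'.
      - apply (is_lim_seq_subseq shrink 1 N2 H2 shrink_lim).
      - apply is_lim_seq_mult'; [exact Hr2|apply is_lim_seq_const]. }
    assert (L3 : is_lim_seq (fun N => sqrt (ratio N (N1 N) * ratio N (N2 N)) * Jb)
                   (sqrt (a1 * a2) * Jb)).
    { apply is_lim_seq_mult'; [|apply is_lim_seq_const].
      apply (filterlim_continuous eventually _ sqrt).
      - apply continuity_pt_filterlim, continuity_pt_sqrt. lra.
      - apply (is_lim_seq_mult' _ _ a1 a2 Hr1 Hr2). }
    assert (Hpos : forall u, filterlim u eventually eventually ->
      eventually (fun N => (0 < u N)%nat)).
    { intros u Hu. apply (Hu (fun n => (0 < n)%nat)). exists 1%nat. intros; lia. }
    generalize (filter_and _ _ (filter_and _ _ (Hpos N1 H1) (Hpos N2 H2))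
      (filter_and _ _ (is_lim_seq_close _ _ e L1 He)
        (filter_and _ _ (is_lim_seq_close _ _ e L2 He) (is_lim_seq_close _ _ e L3 He)))).
    apply filter_imp. intros N [[Hn Hm] [C1 [C2 C3]]] x y.
    eapply Rle_trans; [apply cw_dens_le_gauss2; auto|].
    apply (gauss2_dominated e); auto.
Qed.

(** Two passes of [lsum_cv], with index [(N, x)] and then [N]. Continuity and decay of the marginal
    [G] are inherited from the inner sums that converge to it; the comparison with box integrals
    uses both. *)
Lemma cw_lsum_lim (N1 N2 : nat -> nat) (a1 a2 J1 J2 Jb : R) (o1 o2 : option R) :
  filterlim N1 eventually eventually -> filterlim N2 eventually eventually ->
  is_lim_seq (fun N => ratio N (N1 N)) a1 -> is_lim_seq (fun N => ratio N (N2 N)) a2 ->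
  0 < a1 * a2 -> 0 < 1 - a1 * J1 -> 0 < 1 - a2 * J2 ->
  (sqrt (a1 * a2) * Jb) ^ 2 < (1 - a1 * J1) * (1 - a2 * J2) ->
  let G x := impint o2 (gauss2 (1 - a1 * J1) (1 - a2 * J2) (sqrt (a1 * a2) * Jb) x) in
  (forall x, continuous G x) /\
  (exists L, forall x, Rabs (G x) <= tail_fun L x) /\
  is_lim_seq (fun N => cw_lsum J1 J2 Jb N (N1 N) (N2 N) o1 o2) (impint o1 G).
Proof.
  intros H1 H2 Hr1 Hr2 Ha HA HB Hc G. pose proof PI_RGT_0 as Hpi.
  destruct (cw_dens_dominated N1 N2 a1 a2 J1 J2 Jb H1 H2 Hr1 Hr2 Ha HA HB Hc)
    as [K [HK0 [_ HK]]].
  assert (Hin : forall x, filterlim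
      (fun p : nat * R => lsum (N2 (fst p)) o2 (cw_dens J1 J2 Jb (fst p) (N1 (fst p)) (N2 (fst p)) (snd p)))
      (filter_prod eventually (locally x)) (locally (G x))).
  { intros x.
    apply (lsum_cv (filter_prod eventually (locally x)) (fun p => N2 (fst p))
      (fun p => cw_dens J1 J2 Jb (fst p) (N1 (fst p)) (N2 (fst p)) (snd p))
      (gauss2 (1 - a1 * J1) (1 - a2 * J2) (sqrt (a1 * a2) * Jb) x) (K * K) o2).
    - apply (filterlim_comp _ _ _ fst N2 _ eventually); [apply filterlim_fst|exact H2].
    - intros y. apply cw_dens_lim; auto.
    - apply Filter_prod with (2 := filter_true) (1 := HK).
      intros N z HN _ y. simpl.
      eapply Rle_trans; [apply HN|apply tail_fun_coef_le; lra]. }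
  assert (Hdom : eventually (fun N => forall x,
    Rabs (lsum (N2 N) o2 (cw_dens J1 J2 Jb N (N1 N) (N2 N) x)) <= tail_fun (K * K * (3 * PI)) x)).
  { destruct (mesh_small 1 Rlt_0_1) as [n0 Hn0].
    assert (Hm : eventually (fun N => (n0 <= N2 N)%nat))
      by (apply (H2 (fun n => (n0 <= n)%nat)); exists n0; auto).
    generalize (filter_and _ _ Hm HK). apply filter_imp. intros N [Hn HN] x.
    destruct (Hn0 _ Hn) as [Hp Hmesh].
    eapply Rle_trans; [apply lsum_bound with (K := tail_fun K x * K); auto; lra|].
    right. unfold tail_fun, Rdiv. ring. }
  set (g := fun N x => lsum (N2 N) o2 (cw_dens J1 J2 Jb N (N1 N) (N2 N) x)).
  split; [|split].
  - exact (limit_along_continuous eventually g G Hin).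
  - exists (K * K * (3 * PI)). exact (limit_along_dominated eventually g G _ Hin Hdom).
  - exact (lsum_cv eventually N1 g G _ o1 H1 Hin Hdom).
Qed.

(** The covariance is the inverse of the precision matrix [[[A, - c], [- c, B]]], and its
    determinant is [/ D]. *)
Lemma gauss2_density_eq (A B c x y : R) : 0 < A * B - c ^ 2 ->
  let D := A * B - c ^ 2 in
  gauss2_density (B / D) (c / D) (A / D) x y = sqrt D / (2 * PI) * gauss2 A B c x y.
Proof.
  intros HD D. pose proof PI_RGT_0. unfold gauss2_density, gauss2.
  fold D in HD.
  assert (Ed : B / D * (A / D) - (c / D) ^ 2 = / D).
  { replace (B / D * (A / D) - (c / D) ^ 2) with ((A * B - c ^ 2) / (D * D)) by (field; lra).
    fold D. field. lra. }
  rewrite Ed, sqrt_inv.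
  pose proof (sqrt_lt_R0 D HD).
  replace (- (A / D * x ^ 2 - 2 * (c / D) * x * y + B / D * y ^ 2) / (2 * / D)) with
    ((- A * x ^ 2 + - B * y ^ 2 + 2 * c * x * y) / 2) by (field; lra).
  field. lra.
Qed.

Lemma nat_to_infty_filterlim (u : nat -> nat) : nat_to_infty u -> filterlim u eventually eventually.
Proof.
  intros H P [M HM]. destruct (H M) as [n0 Hn]. exists n0. intros n Hn'. apply HM, Hn, Hn'.
Qed.

(** Convergence in distribution is stated as convergence of distribution functions at every
    [(a, b)], since the normal one is continuous. The common value is the half-plane integral of
    [gauss2] times [w], the reciprocal of its total mass. *)
Theorem theorem2
  (N1 N2 : nat -> nat) (a1 a2 J1 J2 Jb : R)
  (hsize : forall N, (N1 N + N2 N <= N)%nat)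
  (hN1 : nat_to_infty N1) (hN2 : nat_to_infty N2)
  (ha1 : Un_cv (fun N => INR (N1 N) / INR N) a1)
  (ha2 : Un_cv (fun N => INR (N2 N) / INR N) a2)
  (hJ1 : 0 < J1) (hJ2 : 0 < J2) (hJb : 0 < Jb)
  (hDelta : J1 * J2 - Jb ^ 2 > 0)
  (ha1pos : 0 < a1) (ha2pos : 0 < a2)
  (hT1 : J1 < / a1) (hT2 : J2 < / a2)
  (hT12 : Jb ^ 2 < (/ a1 - J1) * (/ a2 - J2)) :
  forall a b : R, exists v : R,
    is_gauss2_cdf (C11 a1 a2 J1 J2 Jb) (C12 a1 a2 J1 J2 Jb) (C22 a1 a2 J1 J2 Jb) a b v /\
    Un_cv (fun N => cw_cdf N (N1 N) (N2 N) J1 J2 Jb a b) v.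
Proof.
  intros a b. pose proof PI_RGT_0 as Hpi.
  apply is_lim_seq_Reals in ha1. apply is_lim_seq_Reals in ha2.
  pose proof (nat_to_infty_filterlim N1 hN1) as H1.
  pose proof (nat_to_infty_filterlim N2 hN2) as H2.
  assert (Ha : 0 < a1 * a2) by (apply Rmult_lt_0_compat; auto).
  assert (HA : 0 < 1 - a1 * J1).
  { replace (1 - a1 * J1) with (a1 * (/ a1 - J1)) by (field; lra).
    apply Rmult_lt_0_compat; lra. }
  assert (HB : 0 < 1 - a2 * J2).
  { replace (1 - a2 * J2) with (a2 * (/ a2 - J2)) by (field; lra).
    apply Rmult_lt_0_compat; lra. }
  assert (Ec : (sqrt (a1 * a2) * Jb) ^ 2 = a1 * a2 * Jb ^ 2).
  { rewrite Rpow_mult_distr, pow2_sqrt by lra. reflexivity. }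
  assert (Hc : (sqrt (a1 * a2) * Jb) ^ 2 < (1 - a1 * J1) * (1 - a2 * J2)).
  (* Multiplied by [a1 * a2], the third temperature condition says that the limiting precision
     matrix has positive determinant. *)
  { rewrite Ec. replace ((1 - a1 * J1) * (1 - a2 * J2)) with
      (a1 * a2 * ((/ a1 - J1) * (/ a2 - J2))) by (field; lra).
    apply Rmult_lt_compat_l; auto. }
  pose proof (fun o1 o2 => cw_lsum_lim N1 N2 a1 a2 J1 J2 Jb o1 o2 H1 H2 ha1 ha2 Ha HA HB Hc) as HL.
  destruct (cw_dens_dominated N1 N2 a1 a2 J1 J2 Jb H1 H2 ha1 ha2 Ha HA HB Hc)
    as [K [HK0 [HK _]]].
  assert (EC : C_den a1 a2 J1 J2 Jb =
    (1 - a1 * J1) * (1 - a2 * J2) - (sqrt (a1 * a2) * Jb) ^ 2) by (rewrite Ec; reflexivity).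
  unfold C11, C12, C22. rewrite EC.
  set (A := 1 - a1 * J1) in *. set (B := 1 - a2 * J2) in *. set (c := sqrt (a1 * a2) * Jb) in *.
  clearbody A B c.
  set (D := A * B - c ^ 2). assert (HD : 0 < D) by (unfold D; lra).
  pose proof (sqrt_lt_R0 D HD) as HsD.
  set (w := sqrt D / (2 * PI)). assert (Hw : 0 < w) by (apply Rdiv_lt_0_compat; lra).
  set (I := impint (Some a) (fun x => impint (Some b) (gauss2 A B c x))).
  exists (w * I). split.
  - destruct (HL (Some a) (Some b)) as [HG [[L HLd] _]].
    assert (Hcy : forall x y, continuous (gauss2 A B c x) y).
    { intros x y. apply continuous_derivable. unfold gauss2. auto_derive; auto. }
    intros eps He.
    destruct (box_integral_cv (gauss2 A B c) (K * K) L a b) with (eps := eps / w)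
      as [M0 HM0]; auto.
    + apply gauss2_continuous.
    + intros x y. eapply Rle_trans; [apply HK|apply tail_fun_coef_le; lra].
    + apply Rdiv_lt_0_compat; auto.
    + exists M0. intros M HM. destruct (HM0 M (Rge_le _ _ HM)) as [HcM Hlim].
      replace (fun x => Rint (fun y => gauss2_density (B / D) (c / D) (A / D) x y) (- M) b)
        with (fun x => w * RInt (gauss2 A B c x) (- M) b).
      * rewrite Rint_RInt.
        -- rewrite (RInt_scal_R (fun x => RInt (gauss2 A B c x) (- M) b)) by exact HcM.
           rewrite <- Rmult_minus_distr_l, Rabs_mult, (Rabs_pos_eq w) by lra.
           apply Rmult_lt_reg_l with (/ w); [apply Rinv_0_lt_compat; auto|].
           rewrite <- Rmult_assoc, Rinv_l, Rmult_1_l by lra.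
           rewrite Rmult_comm. exact Hlim.
        -- apply ex_RInt_everywhere. intros x.
           apply (continuous_mult (K := R_AbsRing) (fun _ => w)); [apply continuous_const|apply HcM].
      * apply functional_extensionality. intros x.
        rewrite <- RInt_scal_R by apply Hcy.
        rewrite <- Rint_RInt.
        -- f_equal. apply functional_extensionality. intros y. symmetry.
           apply gauss2_density_eq. exact HD.
        -- apply ex_RInt_everywhere. intros y.
           apply (continuous_mult (K := R_AbsRing) (fun _ => w)); [apply continuous_const|apply Hcy].
  - apply is_lim_seq_Reals.
    destruct (HL (Some a) (Some b)) as [_ [_ Hnum]].
    destruct (HL None None) as [_ [_ Hden]].
    rewrite gauss2_mass in Hden by auto. fold D in Hden. fold I in Hnum.
    replace (w * I) with (I / (2 * PI / sqrt D)) by (unfold w; field; lra).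
    apply is_lim_seq_ext_loc with
      (fun N => cw_lsum J1 J2 Jb N (N1 N) (N2 N) (Some a) (Some b) /
                cw_lsum J1 J2 Jb N (N1 N) (N2 N) None None).
    (* The quotient formula requires both groups to be nonempty, which holds for all large [N]; then
       [hsize] gives [0 < N]. *)
    + destruct (hN1 1%nat) as [n1 Hn1]. destruct (hN2 1%nat) as [n2 Hn2].
      exists (max n1 n2). intros N HN. symmetry.
      specialize (Hn1 N ltac:(lia)). specialize (Hn2 N ltac:(lia)). specialize (hsize N).
      apply cw_cdf_lsum; lia.
    + apply is_lim_seq_div'; auto.
      apply Rgt_not_eq, Rdiv_lt_0_compat; lra.
Qed.
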